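(* Let $G$ be a countably infinite amenable group, let $G\curvearrowright^T (X,\mu)$ be a measure-preserving action on a standard probability space, and let $\phi:X\to A$ be a measurable map into a finite set $A$. Then for every sofic approximation $\Sigma$ to $G$, the sofic entropy rate $h(\Sigma,\phi)$ equals the classical mean entropy rate $h_\mu(T,\phi)$ of $\phi$.
   Context: For $m\in\mathbb N$ let $[m]=\{1,\dots,m\}$ and let $\mathrm{Sym}(m)$ be the symmetric group on $[m]$. Sofic approximation: a sequence $\Sigma=\{\sigma_i\}_{i=1}^\infty$ of maps $\sigma_i:G\to \mathrm{Sym}(m_i)$ (not assumed to be homomorphisms) such that for all $g,h\in G$, $\lim_i \frac1{m_i}\#\{p\in[m_i]: \sigma_i(g)\sigma_i(h)p=\sigma_i(gh)p\}=1$, for all $g\ne h$ in $G$, $\lim_i \frac1{m_i}\#\{p\in[m_i]:\sigma_i(g)p\neq\sigma_i(h)p\}=1$, and $\lim_i m_i=+\infty$. Sofic entropy rate: for finite $W\subset G$ let $\phi^W:X\to A^W$, $\phi^W(x)(w)=\phi(T_wx)$. For $\sigma:G\to \mathrm{Sym}(m)$ and $\psi:[m]\to A$ let $\psi^W_\sigma:[m]\to A^W$, $\psi_\sigma^W(p)(w)=\psi(\sigma(w)p)$, and let $u$ be the uniform probability measure on $[m]$. Put $d_W((\sigma,\psi),\phi)=\frac12\sum_{a\in A^W}\big|\phi^W_*\mu(\{a\})-(\psi^W_\sigma)_*u(\{a\})\big|$. Then $$h(\Sigma,\phi)=\inf_{W\subset G}\ \inf_{\epsilon>0}\ \limsup_{i\to\infty}\frac{\log\#\{\psi:[m_i]\to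 A:\ d_W((\sigma_i,\psi),\phi)<\epsilon\}}{m_i},$$ where $W$ ranges over finite subsets of $G$ (and $\log 0=-\infty$). Classical mean entropy rate: let $\{F_n\}$ be a left-Følner sequence of $G$ (finite nonempty subsets with $|gF_n\,\Delta\,F_n|/|F_n|\to0$ for every $g\in G$). Then $h_\mu(T,\phi)=\lim_{n\to\infty}H(\phi^{F_n}_*\mu)/|F_n|$, where $H(\nu)=-\sum_x\nu(\{x\})\log\nu(\{x\})$ is Shannon entropy; the limit exists and does not depend on the Følner sequence. *)

(* Defs.v *)
From HB Require Import structures.
From mathcomp Require Import all_boot all_order all_algebra all_fingroup.
From mathcomp Require Import finmap.
From mathcomp Require Import all_classical all_reals all_analysis.

Set Implicit Arguments.
Unset Strict Implicit.
Unset Printing Implicit Defensive.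

Import Order.TTheory GRing.Theory Num.Theory.
Import numFieldNormedType.Exports.

Local Open Scope classical_set_scope.
Local Open Scope ring_scope.

(* A standard Borel space: measurably isomorphic to a separable complete metric
   space with its Borel sigma-algebra. *)
Definition standard_borel (R : realType) (d : measure_display)
    (X : measurableType d) : Prop :=
  exists (P : metricType R) (f : X -> P),
    [/\ forall F : set_system P, ProperFilter F -> cauchy F ->
          exists x : P, F --> x,
        exists2 D : set P, countable D & dense D,
        bijective f
      & @measurable d X =
          preimage_set_system setT f <<s [set U : set P | open U] >>].

Record pmp_action (R : realType) (G : groupType) (d : measure_display)
    (X : measurableType d) (mu : probability X R) (T : G -> X -> X) : Prop :=
  PmpAction {
    pmp_action1 : forall x, T 1%g x = x;
    pmp_actionM : forall g h x, T (g * h)%g x = T g (T h x);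
    pmp_action_measurable : forall g, measurable_fun setT (T g);
    pmp_action_preserving : forall g B, measurable B ->
      pushforward mu (T g) B = mu B }.

Definition symdiff (K : choiceType) (E F : {fset K}) : {fset K} :=
  ((E `\` F) `|` (F `\` E))%fset.

Definition left_folner (R : realType) (G : groupType)
    (F : nat -> {fset G}) : Prop :=
  (forall n, F n != fset0) /\
  (forall g : G,
    (#|` symdiff [fset (g * h)%g | h in F n]%fset (F n) |%:R / #|` F n |%:R : R)
      @[n --> \oo] --> (0 : R)).

(* Amenability in Folner's sense, for countable G. *)
Definition amenable (R : realType) (G : groupType) : Prop :=
  exists F : nat -> {fset G}, left_folner R F.

(* The product of permutations (s * t)%g means "s first"; composites are
   therefore written as iterated applications. *)
Record sofic_approximation (R : realType) (G : groupType) (m : nat -> nat)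
    (sigma : forall i, G -> 'S_(m i)) : Prop :=
  SoficApproximation {
    sofic_mult : forall g h : G,
      (#|[set p | sigma i g (sigma i h p) == sigma i (g * h)%g p]%SET|%:R
         / (m i)%:R : R) @[i --> \oo] --> (1 : R);
    sofic_free : forall g h : G, g != h ->
      (#|[set p | sigma i g p != sigma i h p]%SET|%:R / (m i)%:R : R)
         @[i --> \oo] --> (1 : R);
    sofic_size : m i @[i --> \oo] --> \oo }.

Section Entropy.
Variables (R : realType) (G : groupType) (A : finType).

(* [pattern W] is phi^W and [pattern_law] its law phi^W_* mu on point masses;
   [model_pattern] and [model_law] are psi^W_sigma and (psi^W_sigma)_* u, and
   [pattern_dist W] is d_W. *)
Section Observable.
Variables (d : measure_display) (X : measurableType d).
Variables (mu : probability X R) (T : G -> X -> X) (phi : X -> A).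

Definition pattern (W : {fset G}) (x : X) : {ffun W -> A} :=
  [ffun w => phi (T (val w) x)].

Definition pattern_law (W : {fset G}) (a : {ffun W -> A}) : R :=
  fine (mu (pattern W @^-1` [set a])).

End Observable.

Definition model_pattern (m : nat) (s : G -> 'S_m) (psi : {ffun 'I_m -> A})
    (W : {fset G}) (p : 'I_m) : {ffun W -> A} :=
  [ffun w => psi (s (val w) p)].

Definition model_law (m : nat) (s : G -> 'S_m) (psi : {ffun 'I_m -> A})
    (W : {fset G}) (a : {ffun W -> A}) : R :=
  #|[set p | model_pattern s psi W p == a]%SET|%:R / m%:R.

Definition shannon_entropy (I : finType) (nu : I -> R) : R :=
  - \sum_i nu i * ln (nu i).

Section Rates.
Variables (d : measure_display) (X : measurableType d).
Variables (mu : probability X R) (T : G -> X -> X) (phi : X -> A).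

Definition pattern_dist (W : {fset G}) (m : nat) (s : G -> 'S_m)
    (psi : {ffun 'I_m -> A}) : R :=
  2^-1 * \sum_(a : {ffun W -> A})
            `|pattern_law mu T phi a - model_law s psi a|.

Definition good_models (W : {fset G}) (e : R) (m : nat) (s : G -> 'S_m) :
    {set {ffun 'I_m -> A}} :=
  [set psi | pattern_dist W s psi < e]%SET.

Definition sofic_entropy_rate (m : nat -> nat) (sigma : forall i, G -> 'S_(m i)) :
    \bar R :=
  ereal_inf [set ereal_inf
    [set limn_esup (fun i =>
           (lne (#|good_models W e (sigma i)|%:R)%:E * ((m i)%:R^-1)%:E)%E)
    | e in [set e : R | 0 < e]]
  | W in [set: {fset G}]].

Definition entropy_per_site (W : {fset G}) : R :=
  shannon_entropy (@pattern_law _ _ mu T phi W) / #|` W |%:R.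

(* [limn] is unspecified on divergent sequences, and the value could a priori
   depend on F: use it together with [cvgn], for every left-Folner F. *)
Definition mean_entropy_rate (F : nat -> {fset G}) : R :=
  limn (fun n => entropy_per_site (F n)).

End Rates.
End Entropy.

(* Main.v *)
Require Import Defs.
From HB Require Import structures.
From mathcomp Require Import all_boot all_order all_algebra all_fingroup.
From mathcomp Require Import finmap.
From mathcomp Require Import all_classical all_reals all_analysis.
From mathcomp Require Import ring lra zify.

Set Implicit Arguments.
Unset Strict Implicit.
Unset Printing Implicit Defensive.

Import Order.TTheory GRing.Theory Num.Theory.
Import numFieldNormedType.Exports.

Local Open Scope classical_set_scope.
Local Open Scope ring_scope.

(** Both rates are equal to [min_rate], the infimum of [H(W) / |W|] over the
    nonempty finite [W], where [H(W)] is the entropy of the law of the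
    [W]-pattern. Since [mu] is invariant, [H(W c) = H(W)] for all [c].

    Two of the bounds are Shearer's inequality ([shearer_entropy]): if almost
    every coordinate is covered at least [k] times by sets [S_j], then [k] times
    the joint entropy is at most the sum of the entropies of the restrictions to
    the [S_j], up to an error term. For a left Folner set [E] the sets
    [W c], [c] in [E], meet [E] in such a cover with [k = |W|], so
    [H(E) / |E| <= H(W) / |W| + o(1)] ([pattern_entropy_cover]) and the mean
    entropy rate converges to [min_rate] ([cvg_entropy_per_site]). For a
    labelling [psi] of [m] points drawn uniformly among the good models, the
    sets [sigma(W) p], [p < m], form such a cover, so the logarithm of the
    number of good models is, up to an error term, at most the sum over [p] of
    the entropies of the patterns of [psi] at [p], divided by [|W|]. By concavity
    this sum is at most [m] times the entropy of the averaged pattern law, which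
    is close to the law of the [W]-pattern because every good model has this
    property ([good_models_entropy_bound], [sofic_entropy_rate_le]).

    For the lower bound one has to construct many good models. Draw a uniformly
    random linear order on the [m] points, fix a Folner set [F], and let every
    point [p] choose the first centre [c] in this order among the points
    [c] with [p] in [sigma(F) c]. The points [p] and [sigma(w) p] choose
    different centres only if the first point of the union of their two sets of
    candidates lies outside the intersection, and since [F] is almost invariant
    this is unlikely ([card_separated_centers]). So some order splits the model
    into pieces of size at most [|F|] such that [sigma(W) p] remains in the
    piece of [p] for most [p] ([exists_carving]). Now label the pieces
    independently, each with a pattern drawn from the law of the [F]-pattern.
    At most points the label pattern has exactly the law of the [W]-pattern and
    the pieces are small, so by Chebyshev's inequality the random labelling is
    a good model with probability close to [1] ([not_good_law]). Its entropy is
    the sum of the entropies of the pieces ([entropy_assemble]). Here [min_rate]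
    being an infimum over all finite sets pays off: a piece has entropy at least
    [min_rate] times its size whatever its shape is, and the total is at least
    [m * min_rate] although nothing is known about the shapes. A random variable
    which lies in the set of good models with high probability and has this
    entropy forces that set to be large ([good_models_lower_bound],
    [sofic_entropy_rate_ge]). *)

(** * Entropy of finitely supported laws *)

Section FiniteEntropy.
Variable R : realType.

Lemma gibbs_term (p q : R) : 0 <= p -> 0 <= q -> (q = 0 -> p = 0) ->
  p * (ln q - ln p) <= q - p.
Proof.
move=> p0 q0 qp0; have [->|pn0] := eqVneq p 0; first by rewrite mul0r subr0.
have pgt0 : 0 < p by rewrite lt_neqAle eq_sym pn0.
have qgt0 : 0 < q.
  by rewrite lt_neqAle eq_sym q0 andbT; apply: contra_neq pn0.
rewrite -ln_div ?posrE// -ler_pdivlMl//.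
have -> : p^-1 * (q - p) = q / p - 1 by field.
have := @le_ln1Dx _ (q / p - 1); rewrite (addrC 1) subrK; apply.
by rewrite ltrBrDl subrr divr_gt0.
Qed.

(** Neither weight is normalised: this is what allows comparison with the
    perturbation [q = p' + t] of a probability vector, at the cost of the
    difference of the total masses. *)
Lemma gibbs (I : finType) (p q : I -> R) :
    (forall i, 0 <= p i) -> (forall i, 0 <= q i) ->
    (forall i, q i = 0 -> p i = 0) ->
  shannon_entropy p <= - (\sum_i p i * ln (q i)) + (\sum_i q i - \sum_i p i).
Proof.
move=> p0 q0 qp0; rewrite /shannon_entropy.
have : \sum_i p i * (ln (q i) - ln (p i)) <= \sum_i (q i - p i).
  by apply: ler_sum => i _; apply: gibbs_term => //; exact: qp0.
by under eq_bigr do rewrite mulrBr; rewrite !sumrB; lra.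
Qed.

Section Law.
Variables (Omega : finType) (P : Omega -> R).

Definition law (B : finType) (f : Omega -> B) (b : B) : R :=
  \sum_(o | f o == b) P o.

Definition entropy (B : finType) (f : Omega -> B) : R :=
  shannon_entropy (law f).

Lemma sum_law_comp (B : finType) (f : Omega -> B) (u : B -> R) :
  \sum_b law f b * u b = \sum_o P o * u (f o).
Proof.
rewrite [RHS](partition_big f predT)//=; apply: eq_bigr => b _.
by rewrite /law mulr_suml; apply: eq_bigr => o /eqP ->.
Qed.

Lemma sum_law (B : finType) (f : Omega -> B) : \sum_b law f b = \sum_o P o.
Proof.
by have /= := sum_law_comp f (fun=> 1); rewrite -!mulr_suml !mulr1.
Qed.

(** Written as a sum over [Omega], the entropy depends on [f] only through the
    partition of [Omega] into its level sets. *)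
Lemma entropyE (B : finType) (f : Omega -> B) :
  entropy f = - \sum_o P o * ln (law f (f o)).
Proof.
by rewrite /entropy /shannon_entropy (sum_law_comp f (fun b => ln (law f b))).
Qed.

Hypothesis P_ge0 : forall o, 0 <= P o.

Lemma law_ge0 (B : finType) (f : Omega -> B) b : 0 <= law f b.
Proof. exact: sumr_ge0. Qed.

Lemma le_law (B : finType) (f : Omega -> B) o : P o <= law f (f o).
Proof. by rewrite /law (bigD1 o)//= lerDl sumr_ge0. Qed.

Lemma sum_law_pair (B C : finType) (f : Omega -> B) (g : Omega -> C) c :
  \sum_b law (fun o => (f o, g o)) (b, c) = law g c.
Proof.
rewrite /law [RHS](partition_big f predT)//=; apply: eq_bigr => b _.
by apply: eq_bigl => o; rewrite xpair_eqE andbC.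
Qed.

(** The level sets of [f] are unions of level sets of [g]. With both
    implications this also identifies the entropies of observables that determine
    each other. *)
Lemma entropy_le (B C : finType) (f : Omega -> B) (g : Omega -> C) :
  (forall o o', g o = g o' -> f o = f o') -> entropy f <= entropy g.
Proof.
move=> gf; rewrite !entropyE lerN2; apply: ler_sum => o _.
have [->|Po] := eqVneq (P o) 0; first by rewrite !mul0r.
have Pgt0 : 0 < P o by rewrite lt_neqAle eq_sym Po P_ge0.
rewrite ler_pM2l// ler_ln ?posrE ?(lt_le_trans Pgt0 (le_law _ _))//.
rewrite /law big_mkcond [leRHS]big_mkcond; apply: ler_sum => o' _.
case: eqP => [/gf ->|_]; first by rewrite eqxx.
by case: ifP.
Qed.

(** Gibbs' inequality against the law under which [f] and [g] are conditionally
    independent given [h]. *)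
Lemma entropy_submodular (B C D : finType)
    (f : Omega -> B) (g : Omega -> C) (h : Omega -> D) :
  entropy (fun o => (f o, g o, h o)) + entropy h <=
  entropy (fun o => (f o, h o)) + entropy (fun o => (g o, h o)).
Proof.
set fh := fun o => (f o, h o); set gh := fun o => (g o, h o).
set fgh := fun o => (f o, g o, h o).
pose q (x : B * C * D) :=
  law fh (x.1.1, x.2) * law gh (x.1.2, x.2) / law h x.2.
have lawh0 : forall x : B * C * D, law h x.2 = 0 -> law fgh x = 0.
  move=> -[[b c] d] /= h0; apply/eqP; rewrite eq_le law_ge0 andbT -h0 /law.
  rewrite big_mkcond [leRHS]big_mkcond; apply: ler_sum => o _.
  by rewrite /fgh xpair_eqE; case: (h o == d); rewrite ?andbT ?andbF//; case: ifP.
have lawfh0 : forall x : B * C * D, law fh (x.1.1, x.2) = 0 -> law fgh x = 0.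
  move=> -[[b c] d] /= h0; apply/eqP; rewrite eq_le law_ge0 andbT -h0 /law.
  rewrite big_mkcond [leRHS]big_mkcond; apply: ler_sum => o _.
  rewrite /fgh /fh !xpair_eqE; case: (h o == d); rewrite ?andbT ?andbF//.
  by case: (f o == b); rewrite ?andbT//=; case: ifP.
have lawgh0 : forall x : B * C * D, law gh (x.1.2, x.2) = 0 -> law fgh x = 0.
  move=> -[[b c] d] /= h0; apply/eqP; rewrite eq_le law_ge0 andbT -h0 /law.
  rewrite big_mkcond [leRHS]big_mkcond; apply: ler_sum => o _.
  rewrite /fgh /gh !xpair_eqE; case: (h o == d); rewrite ?andbT ?andbF//.
  by case: (g o == c); rewrite ?andbT ?andbF//=; case: ifP.
have q0 x : 0 <= q x by rewrite /q divr_ge0 ?mulr_ge0 ?law_ge0.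
have q00 x : q x = 0 -> law fgh x = 0.
  move=> /eqP; rewrite !mulf_eq0 invr_eq0 -orbA => /or3P[] /eqP.
  - exact: lawfh0.
  - exact: lawgh0.
  - exact: lawh0.
have := gibbs (fun x => law_ge0 fgh x) q0 q00; rewrite -/(entropy _) => H.
have sumq : \sum_x q x = \sum_o P o.
  rewrite -(sum_law h) -(pair_big predT predT (fun x d => q (x, d)))/=.
  rewrite exchange_big/=.
  apply: eq_bigr => d _.
  rewrite -(pair_big predT predT (fun b c => q (b, c, d)))/= /q/=.
  have -> : \sum_i \sum_j law fh (i, d) * law gh (j, d) / law h d =
     (\sum_i law fh (i, d)) * (\sum_j law gh (j, d)) / law h d.
    by rewrite big_distrlr/= mulr_suml; apply: eq_bigr => i _; rewrite mulr_suml.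
  rewrite !sum_law_pair; have [->|h0] := eqVneq (law h d) 0;
    first by rewrite !mul0r.
  by rewrite mulfK.
rewrite sumq sum_law subrr addr0 in H.
rewrite -lerBrDr; apply: le_trans H _.
rewrite (sum_law_comp fgh (fun x => ln (q x))) /= !entropyE.
have : \sum_o (P o * ln (law fh (fh o)) + P o * ln (law gh (gh o)) -
    P o * ln (law h (h o))) <= \sum_o P o * ln (q (fgh o)); last first.
  by rewrite sumrB big_split/=; lra.
apply: ler_sum => o _.
have [->|Po] := eqVneq (P o) 0; first by rewrite !mul0r subr0 addr0.
have Pgt0 : 0 < P o by rewrite lt_neqAle eq_sym Po P_ge0.
have lgt0 (E : finType) (u : Omega -> E) : law u (u o) \is Num.pos.
  by rewrite posrE (lt_le_trans Pgt0 (le_law _ _)).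
rewrite /q /= ln_div ?posrE ?lnM ?mulr_gt0 -?posrE//.
by rewrite mulrBr mulrDr lexx.
Qed.

End Law.

Section Bounds.
Variables (Omega : finType) (P : Omega -> R).
Hypothesis P_ge0 : forall o, 0 <= P o.
Hypothesis P_sum1 : \sum_o P o = 1.

Lemma entropy_const (B : finType) (f : Omega -> B) :
  (forall o o', f o = f o') -> entropy P f = 0.
Proof.
move=> fc; rewrite entropyE; under eq_bigr => o _.
  rewrite /law (eq_bigl predT) => [|o'] /=; last by rewrite (fc o' o) eqxx.
  rewrite P_sum1 ln1 mulr0; over.
by rewrite big1 ?oppr0.
Qed.

Lemma entropy_ge0 (B : finType) (f : Omega -> B) : 0 <= entropy P f.
Proof.
by rewrite -(@entropy_const _ (fun=> tt))//; apply: entropy_le.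
Qed.

Lemma entropy_le_card (B : finType) (f : Omega -> B) :
  entropy P f <= ln #|B|%:R.
Proof.
have [x _] : exists x, P x != 0.
  apply/existsP; apply: contraT; rewrite negb_exists => /forallP P0.
  have : \sum_o P o = 0 by apply: big1 => o _; apply/eqP; rewrite -[_ == _]negbK.
  by rewrite P_sum1 => /eqP; rewrite oner_eq0.
have B0 : (0 < #|B|)%N by apply/card_gt0P; exists (f x).
have B0' : 0 < (#|B|%:R : R) by rewrite ltr0n.
have /= := @gibbs _ (law P f) (fun=> #|B|%:R^-1) (law_ge0 P_ge0 f)
  (fun _ => ltW (etrans (invr_gt0 _) B0')).
rewrite -/(entropy P f) sumr_const -(mulr_natr _^-1) mulVf ?gt_eqF// sum_law
  P_sum1 subrr addr0.
rewrite -mulr_suml sum_law P_sum1 mul1r lnV ?posrE// opprK; apply => i /eqP.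
by rewrite invr_eq0 gt_eqF.
Qed.

(** Gibbs' inequality against the even mixture of the uniform laws on [good] and
    on [B]: an observable of large entropy that mostly lies in [good] forces
    [good] to be large. *)
Lemma entropy_le_good (B : finType) (f : Omega -> B) (good : {set B}) :
    (0 < #|good|)%N ->
  entropy P f <= ln 2 + ln #|good|%:R +
    (\sum_(b | b \notin good) law P f b) * ln #|B|%:R.
Proof.
move=> good0; have good0' : 0 < (#|good|%:R : R) by rewrite ltr0n.
have B0 : (0 < #|B|)%N by apply: leq_trans good0 (max_card _).
have B0' : 0 < (#|B|%:R : R) by rewrite ltr0n.
(* On [good] only the first component of the mixture is kept, so that the total
   mass is at most one. *)
pose q (b : B) : R := if b \in good then (2 * #|good|%:R)^-1 else (2 * #|B|%:R)^-1.
have qgt0 b : 0 < q b by rewrite /q; case: ifP => _; rewrite invr_gt0 mulr_gt0.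
have H := @gibbs _ (law P f) q (law_ge0 P_ge0 f) (fun b => ltW (qgt0 b)).
apply: le_trans (H _) _; first by move=> b qb; move: (qgt0 b); rewrite qb ltxx.
have sumq : \sum_b q b <= 1.
  rewrite (bigID (mem good))/=.
  have -> : \sum_(i in good) q i = 2^-1.
    rewrite (eq_bigr (fun=> (2 * #|good|%:R)^-1)) => [|b bg]; last by rewrite /q bg.
    by rewrite sumr_const -(mulr_natr _^-1); field; rewrite gt_eqF.
  have half : 2^-1 + 2^-1 <= 1 :> R by lra.
  apply: le_trans half; rewrite lerD2l;
    apply: (@le_trans _ _ (\sum_b (2 * #|B|%:R)^-1)).
    rewrite big_mkcond/=; apply: ler_sum => b _; rewrite /q.
    by case: (b \in good) => //=; rewrite invr_ge0 mulr_ge0// ltW.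
  rewrite sumr_const -(mulr_natr _^-1).
  suff -> : (2 * #|B|%:R)^-1 * #|B|%:R = 2^-1 :> R by [].
  by field; rewrite gt_eqF.
rewrite sum_law P_sum1.
have lq b : - ln (q b) <= ln 2 + ln #|good|%:R + (b \notin good)%:R * ln #|B|%:R.
  rewrite /q; case: ifP => bg /=;
    rewrite lnV ?opprK ?posrE ?mulr_gt0// lnM ?posrE//.
    by rewrite mul0r addr0.
  rewrite mul1r -addrA lerD2l lerDr ln_ge0// ler1n//.
apply: (@le_trans _ _ (- (\sum_i law P f i * ln (q i)))).
  by rewrite gerDl subr_le0.
rewrite -sumrN; apply: (@le_trans _ _ (\sum_b law P f b *
   (ln 2 + ln #|good|%:R + (b \notin good)%:R * ln #|B|%:R))).
  by apply: ler_sum => b _; rewrite -mulrN ler_wpM2l ?law_ge0.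
under eq_bigr do rewrite mulrDr mulrA.
rewrite big_split/= -!mulr_suml sum_law P_sum1 mul1r lerD2l.
rewrite [in leRHS]big_mkcond/= le_eqVlt; apply/orP; left; apply/eqP; congr (_ * _).
by apply: eq_bigr => b _; case: ifP; rewrite ?mulr1 ?mulr0.
Qed.

End Bounds.

Definition uniform_on (B : finType) (S : {set B}) (b : B) : R :=
  if b \in S then #|S|%:R^-1 else 0.

Lemma uniform_on_ge0 (B : finType) (S : {set B}) b : 0 <= uniform_on S b.
Proof. by rewrite /uniform_on; case: ifP => // _; rewrite invr_ge0. Qed.

Lemma sum_uniform_on (B : finType) (S : {set B}) (u : B -> R) :
  \sum_b uniform_on S b * u b = #|S|%:R^-1 * \sum_(b in S) u b.
Proof.
rewrite mulr_sumr [RHS]big_mkcond; apply: eq_bigr => b _.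
by rewrite /uniform_on; case: ifP; rewrite ?mul0r.
Qed.

Lemma sum_uniform_on1 (B : finType) (S : {set B}) : (0 < #|S|)%N ->
  \sum_b uniform_on S b = 1.
Proof.
move=> S0; under eq_bigr do rewrite -[uniform_on S _]mulr1.
by rewrite sum_uniform_on sumr_const mulVf// pnatr_eq0 -lt0n.
Qed.

Lemma entropy_uniform_on (B : finType) (S : {set B}) : (0 < #|S|)%N ->
  entropy (uniform_on S) id = ln #|S|%:R.
Proof.
move=> S0; have S0' : 0 < (#|S|%:R : R) by rewrite ltr0n.
rewrite entropyE sum_uniform_on.
rewrite (eq_bigr (fun=> - ln #|S|%:R)) => [|b bS].
  by rewrite sumr_const -(mulr_natl (- ln _)) mulKf ?gt_eqF// opprK.
by rewrite /law big_pred1_eq /uniform_on bS lnV// posrE.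
Qed.
End FiniteEntropy.

(** * Shearer's inequality *)

Section Shearer.
Variable R : realType.

(** Adding a point [i] to [U] raises [h (S j :&: U)], for the at least [k] indices
    [j] with [i] in [S j], at least as much as it raises [h U]. The points of [D],
    which may be covered fewer times, raise [h U] by at most [b] each. *)
Lemma shearer_submodular (I J : finType) (h : {set I} -> R) (S : J -> {set I})
    (k : nat) (b : R) (D : {set I}) :
    h finset.set0 = 0 ->
    (forall i (U V : {set I}), U \subset V -> i \notin V ->
      h (i |: V)%SET + h U <= h (i |: U)%SET + h V) ->
    (forall U V : {set I}, U \subset V -> h U <= h V) ->
    (forall i, h [set i]%SET <= b) ->
    (forall i, i \notin D -> (k <= #|[set j | i \in S j]%SET|)%N) ->
  forall U : {set I},
    k%:R * h U <= \sum_j h (S j :&: U)%SET + k%:R * (b * #|D :&: U|%:R).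
Proof.
move=> h0 hsub hmon hb hk U; have [n] := ubnP #|U|.
elim: n U => // n IH U; rewrite ltnS => Un.
have [->|[i iU]] := set_0Vmem U.
  rewrite h0 mulr0 big1 ?add0r ?finset.setI0 ?cards0 ?mulr0// => j _.
  by rewrite finset.setI0.
have iV : i \notin (U :\ i)%SET by rewrite !inE eqxx.
have UE : U = (i |: (U :\ i))%SET by rewrite finset.setD1K.
move: iV UE; set V := (U :\ i)%SET => iV UE.
have cV : (#|V| < n)%N by move: Un; rewrite (cardsD1 i U) iU.
have hVU : h V <= h U by apply: hmon; rewrite UE finset.subsetUr.
(* The bound that is used at the points of [D]. *)
have step1 : h U <= h V + b.
  have := hsub i finset.set0 V (finset.sub0set _) iV.
  by rewrite -UE h0 addr0 finset.setU0 addrC => /le_trans; apply; rewrite lerD2l.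
have step j : h (S j :&: V)%SET + (i \in S j)%:R * (h U - h V) <=
    h (S j :&: U)%SET.
  have [iS|iS] := boolP (i \in S j); last first.
    by rewrite mul0r addr0; apply: hmon; apply: finset.setIS;
      rewrite UE finset.subsetUr.
  rewrite mul1r.
  have -> : (S j :&: U)%SET = (i |: (S j :&: V))%SET.
    by apply/finset.setP=> x; rewrite UE !inE; case: eqVneq => [->|]; rewrite ?iS.
  have := hsub i (S j :&: V)%SET V (finset.subsetIr _ _) iV; rewrite -UE; lra.
have sumS : \sum_j ((i \in S j)%:R : R) = #|[set j | i \in S j]%SET|%:R.
  rewrite -sum1_card natr_sum [RHS]big_mkcond; apply: eq_bigr => j _.
  by rewrite inE; case: (i \in S j).
have : \sum_j h (S j :&: V)%SET + #|[set j | i \in S j]%SET|%:R * (h U - h V) <=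
    \sum_j h (S j :&: U)%SET.
  rewrite -sumS mulr_suml -big_split/=; exact: ler_sum.
have := IH V cV.
have [iD|iD] := boolP (i \in D).
  have -> : #|D :&: U|%:R = #|D :&: V|%:R + 1 :> R.
    rewrite natr1 (cardsD1 i (D :&: U)%SET) inE iD iU/= add1n.
    by congr (_.+1%:R); apply: eq_card => x; rewrite !inE; case: eqP;
      rewrite ?andbF.
  have : k%:R * (h U - h V) <= k%:R * b by rewrite ler_wpM2l//; lra.
  have : 0 <= #|[set j | i \in S j]%SET|%:R * (h U - h V).
    by rewrite mulr_ge0// subr_ge0.
  lra.
have -> : #|D :&: U| = #|D :&: V|.
  apply: eq_card => x; rewrite !inE; case: eqVneq => //= ->.
  by rewrite (negbTE iD).
have : k%:R * (h U - h V) <= #|[set j | i \in S j]%SET|%:R * (h U - h V).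
  by rewrite ler_wpM2r ?subr_ge0// ler_nat hk.
lra.
Qed.

(** Values off [U] are erased rather than the index type changed, so that
    restrictions to different sets have the same type. *)
Definition restr (I A : finType) (U : {set I}) (x : {ffun I -> A}) :
  {ffun I -> option A} := [ffun i => if i \in U then Some (x i) else None].

Lemma restrP (I A : finType) (U : {set I}) (x y : {ffun I -> A}) :
  restr U x = restr U y <-> {in U, x =1 y}.
Proof.
split=> [/ffunP xy i iU|xy]; first by have := xy i; rewrite !ffunE iU => -[].
by apply/ffunP=> i; rewrite !ffunE; case: ifP => // iU; rewrite xy.
Qed.

Lemma shearer_entropy (Omega : finType) (P : Omega -> R) (I J A : finType)
    (X : Omega -> {ffun I -> A}) (S : J -> {set I}) (k : nat) (D : {set I}) :
    (forall o, 0 <= P o) -> \sum_o P o = 1 ->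
    (forall i, i \notin D -> (k <= #|[set j | i \in S j]%SET|)%N) ->
  k%:R * entropy P X <=
    \sum_j entropy P (fun o => restr (S j) (X o)) +
    k%:R * (ln #|A|%:R * #|D|%:R).
Proof.
move=> P0 P1 hk; pose h (U : {set I}) := entropy P (fun o => restr U (X o)).
have h0 : h finset.set0 = 0.
  by apply: entropy_const => // o o'; apply/restrP => i; rewrite inE.
have hmon (U V : {set I}) : U \subset V -> h U <= h V.
  move=> UV; apply: entropy_le => // o o' /restrP oo'; apply/restrP => i iU.
  by apply: oo'; exact: (fintype.subsetP UV).
have hb i : h [set i]%SET <= ln #|A|%:R.
  apply: le_trans (entropy_le_card P0 P1 (fun o => X o i)).
  apply: entropy_le => // o o' oo'; apply/restrP => _ /set1P -> //.
have hsub i (U V : {set I}) : U \subset V -> i \notin V ->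
    h (i |: V)%SET + h U <= h (i |: U)%SET + h V.
  move=> UV iV; have := entropy_submodular P0 (fun o => X o i)
    (fun o => restr V (X o)) (fun o => restr U (X o)).
  move=> H; apply: le_trans (le_trans H _); rewrite -/(h U).
    rewrite lerD2r; apply: entropy_le => // o o' [Xi /restrP VV _].
    by apply/restrP => j /setU1P[->//|]; exact: VV.
  apply: lerD; apply: entropy_le => // o o' /restrP oo'; congr (_, _).
  - by apply: oo'; rewrite !inE eqxx.
  - by apply/restrP => j jU; apply: oo'; rewrite !inE jU orbT.
  - exact/restrP.
  - by apply/restrP => j jU; apply: oo'; exact: (fintype.subsetP UV).
have := shearer_submodular h0 hsub hmon hb hk [set: I]%SET.
rewrite !finset.setIT; under eq_bigr do rewrite finset.setIT.
apply: le_trans; rewrite ler_wpM2l//; apply: entropy_le => // o o' /restrP oo'.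
by apply/ffunP => i; apply: oo'; rewrite inE.
Qed.

End Shearer.

(** * Limits and counting *)

Lemma cvg_sum0 (R : realType) (I : finType) (u : I -> nat -> R) :
  (forall i, u i n @[n --> \oo] --> (0 : R)) ->
  \sum_i u i n @[n --> \oo] --> (0 : R).
Proof.
move=> u0; elim: (index_enum I) => [|i s IH];
  first by under eq_fun do rewrite big_nil; exact: cvg_cst.
under eq_fun do rewrite big_cons.
by have := cvgD (u0 i) IH; rewrite addr0; apply.
Qed.

Lemma card_exists_le (I T : finType) (Q : I -> pred T) :
  (#|[set x | [exists i, Q i x]]%SET| <= \sum_i #|[set x | Q i x]%SET|)%N.
Proof.
rewrite -sum1_card big_mkcond/=.
under [X in (_ <= X)%N]eq_bigr do rewrite -sum1_card big_mkcond/=.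
rewrite exchange_big/=; apply: leq_sum => x _; rewrite inE.
case: existsP => // -[i Qix]; rewrite (bigD1 i)//= inE Qix.
exact: leq_addr.
Qed.

Section LimitSuperior.
Variable R : realType.

Lemma limn_esup_le_near (u : nat -> \bar R) (M : \bar R) :
  (\forall n \near \oo, (u n <= M)%E) -> (limn_esup u <= M)%E.
Proof.
move=> uM; apply: (@le_trans _ _ (ereal_sup (u @` [set n | (u n <= M)%E]))).
  by apply: ereal_inf_lbound; exists [set n | (u n <= M)%E].
by apply: ge_ereal_sup => _ [n /= un <-].
Qed.

Lemma limn_esup_ge_near (u : nat -> \bar R) (M : \bar R) :
  (\forall n \near \oo, (M <= u n)%E) -> (M <= limn_esup u)%E.
Proof.
move=> uM; apply: le_ereal_inf_tmp => _ [V Voo <-].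
have [n [un Vn]] := filter_ex (filterI uM Voo).
by apply: (le_trans un); apply: ereal_sup_ubound; exists n.
Qed.

End LimitSuperior.

(** * Laws of patterns *)

Section FinitelyValued.
Variables (R : realType) (d : measure_display) (X : measurableType d).
Variable mu : probability X R.

Lemma fine_preimage_seq (B : eqType) (g : X -> B) (s : seq B) :
    (forall b, measurable (g @^-1` [set b])) -> uniq s ->
  measurable (g @^-1` [set b | b \in s]) /\
  fine (mu (g @^-1` [set b | b \in s])) =
  \sum_(b <- s) fine (mu (g @^-1` [set b])).
Proof.
move=> mg; elim: s => [|b s IH] /=.
  move=> _; rewrite big_nil (_ : [set _ | _] = set0) ?preimage_set0 ?measure0//.
  by apply/seteqP; split.
move=> /andP[bs us]; have [ms IHs] := IH us.
rewrite (_ : g @^-1` _ = g @^-1` [set b] `|` g @^-1` [set b | b \in s]); last first.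
  apply/seteqP; split => x /=; rewrite inE; first by case/orP => [/eqP|];
    [left|right].
  by case=> [->|->]; rewrite ?eqxx ?orbT.
split; first exact: measurableU.
rewrite big_cons -IHs measureU//; last first.
  apply/seteqP; split => // x /= [xb]; rewrite xb => bs'.
  by rewrite bs' in bs.
by rewrite fineD ?fin_num_measure.
Qed.

Lemma fine_preimage (B : finType) (g : X -> B) (Q : pred B) :
    (forall b, measurable (g @^-1` [set b])) ->
  fine (mu (g @^-1` [set b | Q b])) = \sum_(b | Q b) fine (mu (g @^-1` [set b])).
Proof.
move=> mg; have [_] := fine_preimage_seq mg (enum_uniq Q).
rewrite big_enum => <-; congr (fine (mu _)).
by apply/seteqP; split => x /=; rewrite mem_enum.
Qed.

End FinitelyValued.

Section Patterns.
Variables (R : realType) (G : groupType) (A : finType).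
Variables (d : measure_display) (X : measurableType d).
Variables (mu : probability X R) (T : G -> X -> X) (phi : X -> A).
Hypothesis T_pmp : pmp_action mu T.
Hypothesis phi_measurable : forall B : set A, measurable (phi @^-1` B).
Local Notation plaw := (pattern_law mu T phi).
Local Notation H W := (shannon_entropy (@pattern_law R G A d X mu T phi W)).

Lemma measurable_pattern (W : {fset G}) (a : {ffun W -> A}) :
  measurable (pattern T phi W @^-1` [set a]).
Proof.
rewrite (_ : _ @^-1` _ =
  \bigcap_(w in [set: W]) (T (val w) @^-1` (phi @^-1` [set a w]))).
  apply: fin_bigcap_measurable => // w _.
  have := pmp_action_measurable T_pmp (val w) measurableT
    (phi_measurable [set a w]).
  by rewrite setTI.
apply/seteqP; split => x /=.
  by move=> <- w _ /=; rewrite /pattern ffunE.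
by move=> xa; apply/ffunP => w; rewrite /pattern ffunE; exact: xa.
Qed.

Lemma pattern_law_ge0 (W : {fset G}) (a : {ffun W -> A}) : 0 <= plaw a.
Proof. exact: fine_ge0. Qed.

Lemma sum_pattern_law (W : {fset G}) : \sum_(a : {ffun W -> A}) plaw a = 1.
Proof.
rewrite -[LHS](fine_preimage mu predT (@measurable_pattern W)).
rewrite (_ : _ @^-1` _ = setT) ?probability_setT//.
by apply/seteqP; split.
Qed.

(** Marginals are consistent, and right translation by [c] amounts to replacing
    [x] by [T c x], which [mu] does not see. *)
Lemma pattern_law_translate (V W : {fset G}) (c : G) (u : W -> V) :
    (forall w, val (u w) = (val w * c)%g) ->
  law (@pattern_law R G A d X mu T phi V)
    (fun o : {ffun V -> A} => [ffun w => o (u w)])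
  =1 @pattern_law R G A d X mu T phi W.
Proof.
move=> uE a; rewrite /law.
rewrite -(fine_preimage mu
  (fun o : {ffun V -> A} => [ffun w => o (u w)] == a) (@measurable_pattern V)).
rewrite /pattern_law.
rewrite -(pmp_action_preserving T_pmp c (measurable_pattern a)) /pushforward.
congr (fine (mu _)); apply/seteqP; split => x /=.
  move=> /eqP <-; apply/ffunP => w.
  by rewrite !ffunE uE (pmp_actionM T_pmp).
move=> <-; apply/eqP; apply/ffunP => w.
by rewrite !ffunE uE (pmp_actionM T_pmp).
Qed.

Lemma entropy_translate (V W : {fset G}) (c : G) (u : W -> V) :
    (forall w, val (u w) = (val w * c)%g) ->
  entropy (@pattern_law R G A d X mu T phi V)
    (fun o : {ffun V -> A} => [ffun w => o (u w)]) = H W.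
Proof.
move=> uE; rewrite /entropy /shannon_entropy; congr (- _).
by apply: eq_bigr => a _; rewrite (pattern_law_translate uE).
Qed.

Lemma pattern_entropy_ge0 (W : {fset G}) : 0 <= H W.
Proof.
rewrite -(@entropy_translate W W 1%g id) => [|w]; last by rewrite mulg1.
by apply: entropy_ge0; [exact: pattern_law_ge0|exact: sum_pattern_law].
Qed.

Definition min_rate : R :=
  inf [set entropy_per_site mu T phi W | W in [set W : {fset G} | W != fset0]].

Lemma min_rate_le (W : {fset G}) : min_rate * #|` W|%:R <= H W.
Proof.
have [->|W0] := eqVneq W fset0; first by rewrite cardfs0 mulr0 pattern_entropy_ge0.
have W0' : 0 < (#|` W|%:R : R) by rewrite ltr0n cardfs_gt0.
rewrite -ler_pdivlMr//; apply: ge_inf; last by exists W.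
by exists 0 => _ [V V0 <-]; rewrite divr_ge0// pattern_entropy_ge0.
Qed.

Lemma min_rate_approx (e : R) : 0 < e ->
  exists W : {fset G}, [/\ W != fset0 & H W <= (min_rate + e) * #|` W|%:R].
Proof.
move=> e0; have hi : has_inf
    [set entropy_per_site mu T phi W | W in [set W : {fset G} | W != fset0]].
  split; last by exists 0 => _ [V V0 <-]; rewrite divr_ge0// pattern_entropy_ge0.
  exists (entropy_per_site mu T phi [fset 1%g]%fset); exists [fset 1%g]%fset => //=.
  by apply/fset0Pn; exists 1%g; rewrite inE.
have [_ [W W0 <-] We] := inf_adherent e0 hi; exists W; split => //.
by rewrite -ler_pdivrMr ?ltr0n ?cardfs_gt0// ltW.
Qed.

(** The infimum defining [min_rate] ranges over all finite sets, so the bound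
    holds for parts [U] of [F] of any shape. *)
Lemma pattern_entropy_subrate (F : {fset G}) (U : {set F}) :
  min_rate * #|U|%:R <=
  entropy (@pattern_law R G A d X mu T phi F) (fun o : {ffun F -> A} => restr U o).
Proof.
pose W : {fset G} := [fset val f | f in U]%fset.
have WF w : w \in W -> w \in F by move=> /imfsetP[f _ ->]; exact: valP.
have cW : #|` W| = #|U|.
  by rewrite card_imfset//=; [rewrite -cardE|exact: val_inj].
rewrite -cW; apply: le_trans (min_rate_le W) _.
pose u (w : W) : F := [` WF _ (valP w)]%fset.
rewrite -(@entropy_translate F W 1%g u) => [|w]; last by rewrite mulg1.
apply: entropy_le; first exact: pattern_law_ge0.
move=> o o' /restrP oo'; apply/ffunP=> w; rewrite !ffunE; apply: oo'.
have /imfsetP[f /= fU wf] := valP w.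
by rewrite (_ : u w = f)//; exact: val_inj.
Qed.

End Patterns.

(** * The mean entropy rate along Folner sequences *)

Section Classical.
Variables (R : realType) (G : groupType) (A : finType).
Variables (d : measure_display) (X : measurableType d).
Variables (mu : probability X R) (T : G -> X -> X) (phi : X -> A).
Hypothesis T_pmp : pmp_action mu T.
Hypothesis phi_measurable : forall B : set A, measurable (phi @^-1` B).
Local Notation plaw W := (@pattern_law R G A d X mu T phi W).
Local Notation H W := (shannon_entropy (plaw W)).

Lemma card_outside_translate (E : {fset G}) (g : G) :
  (#|[set e : E | (g^-1 * val e)%g \notin E]%SET| <=
     #|` symdiff [fset (g * h)%g | h in E]%fset E|)%N.
Proof.
set U := [set e : E | _]%SET.
have <- : #|` [fset val e | e in U]%fset| = #|U|.
  by rewrite card_imfset//=; [rewrite -cardE|exact: val_inj].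
apply: fsubset_leq_card; apply/fsubsetP => _ /imfsetP[e /= + ->].
rewrite inE => ge; rewrite !inE (valP e) !andbT; apply/orP; right.
apply/negP => /imfsetP[h /= hE eE]; move: ge.
by rewrite /= eE mulKg hE.
Qed.

Lemma card_outside_translates (W E : {fset G}) :
  (#|[set e : E | [exists w : W, ((val w)^-1 * val e)%g \notin E]]%SET| <=
     \sum_(w : W) #|` symdiff [fset (val w * h)%g | h in E]%fset E|)%N.
Proof.
apply: (@leq_trans (\sum_(w : W)
    #|[set e : E | ((val w)^-1 * val e)%g \notin E]%SET|)%N); last first.
  by apply: leq_sum => w _; exact: card_outside_translate.
exact: card_exists_le.
Qed.

(** A point [e] of [E] lies in [W c] exactly for [c = w^-1 e], so the translates
    centred in [E] cover it [|W|] times unless some [w^-1 e] leaves [E]. *)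
Lemma pattern_entropy_cover (W E : {fset G}) :
  #|` W|%:R * H E <= #|` E|%:R * H W + #|` W|%:R *
    (ln #|A|%:R *
     (\sum_(w : W) #|` symdiff [fset (val w * h)%g | h in E]%fset E|)%:R).
Proof.
(* A window containing [E] and all the translates, on which the patterns on
   [E] and on the sets [W c] are observables of one finite law. *)
pose V : {fset G} := (E `|` [fset (w * e)%g | w in W, e in E])%fset.
have EV e : e \in E -> e \in V by move=> eE; rewrite inE eE.
have WEV w e : w \in W -> e \in E -> (w * e)%g \in V.
  by move=> wW eE; rewrite inE; apply/orP; right; exact: in_imfset2.
pose uE (e : E) : V := [` EV _ (valP e)]%fset.
pose uW (c : E) (w : W) : V := [` WEV _ _ (valP w) (valP c)]%fset.
pose S (c : E) := [set e : E | (val e * (val c)^-1)%g \in W]%SET.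
pose D := [set e : E | [exists w : W, ((val w)^-1 * val e)%g \notin E]]%SET.
pose XE (o : {ffun V -> A}) : {ffun E -> A} := [ffun e => o (uE e)].
have hk e : e \notin D -> (#|` W| <= #|[set c | e \in S c]%SET|)%N.
  rewrite inE negb_exists => /forallP he.
  have weE (w : W) : ((val w)^-1 * val e)%g \in E by rewrite -[_ \in _]negbK.
  pose f (w : W) : E := [` weE w]%fset.
  have finj : injective f.
    by move=> w w' /(congr1 val) /= /mulIg /invg_inj; exact: val_inj.
  rewrite cardfE -(card_imset _ finj).
  apply: subset_leq_card; apply/fintype.subsetP => _ /imsetP[w _ ->].
  by rewrite !inE /= invMg invgK mulgA mulgV mul1g; exact: valP.
have P0 := pattern_law_ge0 mu T phi (W := V).
have P1 := sum_pattern_law T_pmp phi_measurable V.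
have := shearer_entropy XE P0 P1 hk.
rewrite (entropy_translate T_pmp phi_measurable (c := 1%g)); last first.
  by move=> e; rewrite mulg1.
move=> /le_trans; apply; apply: lerD.
  rewrite cardfE mulr_natl -sumr_const; apply: ler_sum => c _.
  rewrite -(entropy_translate T_pmp phi_measurable (c := val c) (u := uW c)) => //.
  apply: entropy_le => // o o' oo'; apply/restrP => e; rewrite inE => ec.
  have := congr1 (fun z : {ffun W -> A} => z [` ec]%fset) oo'; rewrite !ffunE.
  suff -> : uW c [` ec]%fset = uE e by [].
  by apply: val_inj => /=; rewrite mulgKV.
rewrite ler_wpM2l// ler_wpM2l ?ler_nat ?card_outside_translates//.
have [->|A0] := posnP #|A|; first by rewrite ln0.
by rewrite ln_ge0// ler1n.
Qed.

Lemma cvg_entropy_per_site (F : nat -> {fset G}) : left_folner R F ->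
  entropy_per_site mu T phi (F n) @[n --> \oo] --> min_rate mu T phi.
Proof.
move=> [F0 F_inv]; have F0' n : 0 < (#|` F n|%:R : R) by rewrite ltr0n cardfs_gt0.
apply/cvgrPdist_le => e e0.
have e20 : 0 < e / 2 by rewrite divr_gt0.
have [W [W0 HW]] := min_rate_approx T_pmp phi_measurable e20.
have W0' : 0 < (#|` W|%:R : R) by rewrite ltr0n cardfs_gt0.
pose bd n : R := ln #|A|%:R * \sum_(w : W)
  #|` symdiff [fset (val w * h)%g | h in F n]%fset (F n)|%:R / #|` F n|%:R.
have bd0 : bd n @[n --> \oo] --> (0 : R).
  rewrite -[X in _ --> X](mulr0 (ln #|A|%:R)); apply: cvgMl_tmp.
  by apply: cvg_sum0 => w; exact: F_inv.
near=> n.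
have lo : min_rate mu T phi <= entropy_per_site mu T phi (F n).
  by rewrite /entropy_per_site ler_pdivlMr// min_rate_le.
rewrite ler_norml; apply/andP; split; last lra.
suff : entropy_per_site mu T phi (F n) <= min_rate mu T phi + e / 2 + bd n.
  have : bd n <= e / 2; last by lra.
  by near: n; move/cvgr0Pnorm_le: bd0 => /(_ _ e20); apply: filterS => n;
    exact: ler_normlW.
rewrite /entropy_per_site ler_pdivrMr// -(ler_pM2l W0').
apply: le_trans (pattern_entropy_cover W (F n)) _.
rewrite (mulrDl _ (bd n)) mulrDr; apply: lerD.
  apply: le_trans (ler_wpM2l (ltW (F0' n)) HW) _.
  by rewrite le_eqVlt; apply/orP; left; apply/eqP; ring.
rewrite ler_pM2l// /bd -mulrA -mulr_suml -natr_sum mulfVK ?gt_eqF//.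
Unshelve. all: by end_near. Qed.

End Classical.

(** * Asymptotic negligibility of the defects of a sofic approximation *)

Section SoficDefects.
Variables (R : realType) (G : groupType) (m : nat -> nat).
Variable sigma : forall i, G -> 'S_(m i).
Hypothesis sigma_sofic : sofic_approximation R sigma.

Lemma near_size (n : nat) : \forall i \near \oo, (n <= m i)%N.
Proof. exact: (proj1 (cvgnyPge m) (sofic_size sigma_sofic) n). Qed.

Lemma near_size_gt (x : R) : \forall i \near \oo, x < (m i)%:R.
Proof.
near=> i; apply: (@le_lt_trans _ _ `|x|); first exact: ler_norm.
apply: (@lt_le_trans _ _ (Num.bound `|x|)%:R).
  exact: archi_boundP.
by rewrite ler_nat; near: i; exact: near_size.
Unshelve. all: by end_near. Qed.

(** The two fractions add up to one once the model is nonempty. *)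
Lemma cvg_compl_fraction (Q : forall i, pred 'I_(m i)) :
    (#|[set p | Q i p]%SET|%:R / (m i)%:R : R) @[i --> \oo] --> (1 : R) ->
  (#|[set p | ~~ Q i p]%SET|%:R / (m i)%:R : R) @[i --> \oo] --> (0 : R).
Proof.
move=> Q1.
have Q0 : 1 - #|[set p | Q i p]%SET|%:R / (m i)%:R @[i --> \oo] --> (0 : R).
  by rewrite -(subrr 1); apply: cvgB; [exact: cvg_cst|exact: Q1].
suff E : \forall i \near \oo, 1 - #|[set p | Q i p]%SET|%:R / (m i)%:R =
    #|[set p | ~~ Q i p]%SET|%:R / (m i)%:R :> R.
  exact: cvg_trans (near_eq_cvg E) Q0.
near=> i; have m0 : (m i)%:R != 0 :> R.
  by rewrite pnatr_eq0 -lt0n; near: i; exact: near_size.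
have := cardsC [set p | Q i p]%SET.
rewrite (_ : ~: _ = [set p | ~~ Q i p])%SET; last first.
  by apply/finset.setP => p; rewrite !inE.
rewrite card_ord => /(congr1 (fun n => n%:R : R)); rewrite natrD => E.
by rewrite /= -[X in X - _](mulfV m0) -mulrBl -{1}E addrC addrA addNr add0r.
Unshelve. all: by end_near. Qed.

Lemma cvg_mult_defect (g h : G) :
  (#|[set p | sigma i g (sigma i h p) != sigma i (g * h)%g p]%SET|%:R
     / (m i)%:R : R) @[i --> \oo] --> (0 : R).
Proof. exact: (cvg_compl_fraction (sofic_mult sigma_sofic g h)). Qed.

Lemma cvg_free_defect (g h : G) : g != h ->
  (#|[set p | sigma i g p == sigma i h p]%SET|%:R / (m i)%:R : R)
    @[i --> \oo] --> (0 : R).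
Proof.
move=> gh; have := cvg_compl_fraction (sofic_free sigma_sofic gh).
by under eq_fun do under eq_finset do rewrite negbK.
Qed.

Definition coincidences (n : nat) (s : G -> 'S_n) (W : {fset G}) :
    {set 'I_n} :=
  [set q | [exists w : W, [exists w' : W,
    (w != w') && (((s (val w))^-1)%g q == ((s (val w'))^-1)%g q)]]]%SET.

(** Substituting [q = s w p] turns coincidences of inverses into coincidences of
    the permutations themselves, which freeness controls. *)
Lemma card_coincidences (n : nat) (s : G -> 'S_n) (W : {fset G}) :
  (#|coincidences s W| <= \sum_(w : W) \sum_(w' : W)
     (w != w') * #|[set p | s (val w) p == s (val w') p]%SET|)%N.
Proof.
apply: leq_trans (card_exists_le _) _; apply: leq_sum => w _.
apply: leq_trans (card_exists_le _) _; apply: leq_sum => w' _.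
case: (w =P w') => /= _.
  by rewrite leqn0 cards_eq0; apply/eqP/finset.setP => q; rewrite !inE.
rewrite mul1n -(card_imset _ (@perm_inj _ ((s (val w))^-1)%g)).
apply: subset_leq_card; apply/fintype.subsetP => _ /imsetP[q + ->].
by rewrite !inE permKV => /eqP ->; rewrite permKV.
Qed.

Lemma cvg_coincidences (W : {fset G}) :
  (#|coincidences (sigma i) W|%:R / (m i)%:R : R) @[i --> \oo] --> (0 : R).
Proof.
pose bd i : R := \sum_(w : W) \sum_(w' : W) (w != w')%:R *
  (#|[set p | sigma i (val w) p == sigma i (val w') p]%SET|%:R / (m i)%:R).
have bd0 : bd i @[i --> \oo] --> (0 : R).
  apply: cvg_sum0 => w; apply: cvg_sum0 => w'.
  have [_|ww'] := eqVneq w w'; first by under eq_fun do rewrite mul0r;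
    exact: cvg_cst.
  by under eq_fun do rewrite mul1r; exact: cvg_free_defect.
apply: (@squeeze_cvgr _ _ _ _ (fun=> 0) bd) => //; last exact: cvg_cst.
near=> i; rewrite divr_ge0//=.
apply: (@le_trans _ _ ((\sum_(w : W) \sum_(w' : W)
     (w != w') * #|[set p | sigma i (val w) p == sigma i (val w') p]%SET|)%N%:R
     / (m i)%:R)).
  by rewrite ler_wpM2r ?invr_ge0// ler_nat card_coincidences.
rewrite /bd natr_sum mulr_suml; apply: ler_sum => w _.
rewrite natr_sum mulr_suml; apply: ler_sum => w' _.
by rewrite natrM mulrA.
Unshelve. all: by end_near. Qed.

End SoficDefects.

(** * Upper bound for the number of good models *)

Section UpperBound.
Variables (R : realType) (G : groupType) (A : finType).
Variables (d : measure_display) (X : measurableType d).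
Variables (mu : probability X R) (T : G -> X -> X) (phi : X -> A).
Hypothesis T_pmp : pmp_action mu T.
Hypothesis phi_measurable : forall B : set A, measurable (phi @^-1` B).
Local Notation plaw W := (@pattern_law R G A d X mu T phi W).
Local Notation H W := (shannon_entropy (plaw W)).

Section FixedModel.
Variables (m : nat) (s : G -> 'S_m) (W : {fset G}).

Lemma sum_model_pattern (P : {ffun 'I_m -> A} -> R) (a : {ffun W -> A}) :
  (0 < m)%N ->
  \sum_p law P (fun psi => model_pattern s psi W p) a =
  m%:R * \sum_psi P psi * model_law R s psi a.
Proof.
move=> m0; have m0' : (m%:R : R) != 0 by rewrite pnatr_eq0 -lt0n.
rewrite /law; under eq_bigr do rewrite big_mkcond/=.
rewrite exchange_big/= mulr_sumr; apply: eq_bigr => psi _.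
rewrite -big_mkcond/= sumr_const -mulr_natr /model_law.
have -> : #|[pred p | model_pattern s psi W p == a]| =
  #|[set p | model_pattern s psi W p == a]%SET| by apply: eq_card => p;
    rewrite !inE.
by field.
Qed.

(** The parameter [t] bounds the reference weight [plaw W + t] away from zero, so
    that its logarithm is bounded by [- ln t] and the discrepancy [2 * e] between
    the averaged pattern law and [plaw W] costs at most [2 * e * - ln t]. *)
Lemma good_models_entropy_bound (e t : R) :
    (0 < m)%N -> 0 < t <= 2^-1 -> (0 < #|good_models mu T phi W e s|)%N ->
  #|` W|%:R * ln #|good_models mu T phi W e s|%:R <=
    m%:R * (H W + #|{ffun W -> A}|%:R * t + 2 * e * - ln t) +
    #|` W|%:R * (ln #|A|%:R * #|coincidences s W|%:R).
Proof.
set Gam := good_models _ _ _ _ _ _ => m0 /andP[t0 t2] Gam0.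
have m0' : 0 < (m%:R : R) by rewrite ltr0n.
pose P := uniform_on R Gam.
have P0 psi : 0 <= P psi by exact: uniform_on_ge0.
have P1 : \sum_psi P psi = 1 by exact: sum_uniform_on1.
pose S (p : 'I_m) := [set s (val w) p | w : W]%SET.
have hk q : q \notin coincidences s W -> (#|` W| <= #|[set p | q \in S p]%SET|)%N.
  rewrite inE negb_exists => /forallP qc.
  have finj : injective (fun w : W => ((s (val w))^-1)%g q).
    move=> w w' ww'; apply/eqP; have := qc w;
      rewrite negb_exists => /forallP/(_ w').
    by rewrite ww' eqxx andbT negbK.
  rewrite cardfE -(card_imset _ finj).
  apply: subset_leq_card; apply/fintype.subsetP => _ /imsetP[w _ ->].
  by rewrite inE; apply/imsetP; exists w; rewrite // permKV.
have := shearer_entropy id P0 P1 hk; rewrite entropy_uniform_on//.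
move=> /le_trans; apply; rewrite lerD2r.
pose pat p := fun psi : {ffun 'I_m -> A} => model_pattern s psi W p.
apply: (@le_trans _ _ (\sum_p entropy P (pat p))).
  apply: ler_sum => p _; apply: entropy_le => // psi psi' pp'.
  apply/restrP => _ /imsetP[w _ ->].
  by have := congr1 (fun z : {ffun W -> A} => z w) pp'; rewrite !ffunE.
pose N : R := #|{ffun W -> A}|%:R.
pose q a := plaw W a + t.
have qgt0 a : 0 < q a by rewrite ltr_wpDl// pattern_law_ge0.
have sumq : \sum_a q a = 1 + N * t.
  rewrite big_split/= (sum_pattern_law T_pmp phi_measurable) sumr_const.
  by rewrite -(mulr_natl t).
apply: (@le_trans _ _ (\sum_p (- (\sum_a law P (pat p) a * ln (q a)) + N * t))).
  apply: ler_sum => p _.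
  have := gibbs (law_ge0 P0 (pat p)) (fun a => ltW (qgt0 a)).
  rewrite sumq sum_law P1 => /(_ _)/le_trans; apply; last by lra.
  by move=> a qa; move: (qgt0 a); rewrite qa ltxx.
rewrite big_split/= sumrN sumr_const card_ord -(mulr_natl (N * t)).
rewrite exchange_big/=; under eq_bigr do rewrite -mulr_suml sum_model_pattern//
  -mulrA.
rewrite -mulr_sumr -mulrN -mulrDr ler_pM2l//.
pose avg (a : {ffun W -> A}) := \sum_psi P psi * model_law R s psi a.
have dist : \sum_a `|plaw W a - avg a| <= 2 * e.
  have -> : 2 * e = \sum_psi P psi * (2 * e) by rewrite -mulr_suml P1 mul1r.
  apply: (@le_trans _ _ (\sum_a \sum_psi P psi *
      `|plaw W a - model_law R s psi a|)).
    apply: ler_sum => a _.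
    have -> : plaw W a - avg a = \sum_psi P psi * (plaw W a - model_law R s psi a).
      by under eq_bigr do rewrite mulrBr; rewrite sumrB -mulr_suml P1 mul1r.
    apply: le_trans (ler_norm_sum _ _ _) _.
    by apply: ler_sum => psi _; rewrite normrM (ger0_norm (P0 psi)).
  rewrite exchange_big/=; apply: ler_sum => psi _; rewrite -mulr_sumr.
  rewrite /P /uniform_on; case: ifP => [|_]; last by rewrite !mul0r.
  rewrite inE /pattern_dist => /ltW psie; rewrite ler_wpM2l ?invr_ge0//; lra.
have lnq a : `|ln (q a)| <= - ln t.
  have tq : t <= q a by rewrite lerDr pattern_law_ge0.
  have q1 : q a <= t^-1.
    apply: (@le_trans _ _ 2).
      have : plaw W a <= 1.
        rewrite -(sum_pattern_law T_pmp phi_measurable W) (bigD1 a)//= lerDl.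
        by apply: sumr_ge0 => b _; exact: pattern_law_ge0.
      by rewrite /q; lra.
    by rewrite -[leLHS]invrK lef_pV2 ?posrE// invr_gt0.
  rewrite ler_norml opprK ler_ln ?posrE// tq/=.
  by rewrite -lnV ?posrE// ler_ln ?posrE// invr_gt0.
have D1 : \sum_a (plaw W a - avg a) * ln (q a) <= 2 * e * - ln t.
  apply: (@le_trans _ _ (\sum_a `|plaw W a - avg a| * - ln t)); last first.
    rewrite -mulr_suml ler_wpM2r// oppr_ge0 ln_le0//; lra.
  apply: ler_sum => a _; apply: le_trans (ler_norm _) _.
  by rewrite normrM ler_wpM2l.
have D2 : - (\sum_a plaw W a * ln (q a)) <= H W.
  rewrite /shannon_entropy lerN2; apply: ler_sum => a _.
  have := pattern_law_ge0 mu T phi a; rewrite le_eqVlt => /predU1P[<-|a0].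
    by rewrite !mul0r.
  by rewrite ler_pM2l// ler_ln ?posrE// lerDl ltW.
move: D1; under eq_bigr do rewrite mulrBl; rewrite sumrB.
move: D2; rewrite -/N;
under [X in _ -> _ -> - X + _ <= _]eq_bigr do rewrite -/(avg _).
lra.
Qed.

End FixedModel.
End UpperBound.

Section UpperLimit.
Variables (R : realType) (G : groupType) (A : finType).
Variables (d : measure_display) (X : measurableType d).
Variables (mu : probability X R) (T : G -> X -> X) (phi : X -> A).
Hypothesis T_pmp : pmp_action mu T.
Hypothesis phi_measurable : forall B : set A, measurable (phi @^-1` B).
Variables (m : nat -> nat) (sigma : forall i, G -> 'S_(m i)).
Hypothesis sigma_sofic : sofic_approximation R sigma.

Lemma sofic_entropy_rate_le :
  (sofic_entropy_rate mu T phi sigma <= (min_rate mu T phi)%:E)%E.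
Proof.
apply/lee_addgt0Pr => e e0; rewrite -EFinD.
have e4 : 0 < e / 4 by rewrite divr_gt0.
have [W [W0 HW]] := min_rate_approx T_pmp phi_measurable e4.
have W1 : 1 <= #|` W|%:R :> R by rewrite ler1n cardfs_gt0.
have W0' : 0 < (#|` W|%:R : R) by apply: lt_le_trans W1.
pose N : R := #|{ffun W -> A}|%:R.
have N0 : 0 < N + 1 by rewrite ltr_wpDl.
(* [t], then [r], are chosen so that the two error terms of
   [good_models_entropy_bound] are at most [e / 4] each. *)
pose t := Num.min 2^-1 (e / 4 / (N + 1)).
have t0 : 0 < t by rewrite lt_min invr_gt0 ltr0n/= divr_gt0.
have t2 : t <= 2^-1 by rewrite ge_min lexx.
have Nt : N * t <= e / 4.
  apply: (@le_trans _ _ ((N + 1) * t)); first by rewrite ler_wpM2r ?ltW//; lra.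
  by rewrite mulrC -ler_pdivlMr// ge_min lexx orbT.
have lt0' : 0 <= - ln t by rewrite oppr_ge0 ln_le0//; lra.
pose r := e / 4 / (2 * (- ln t + 1)).
have r0 : 0 < r by rewrite divr_gt0// mulr_gt0//; lra.
have rt : 2 * r * - ln t <= e / 4.
  have -> : 2 * r * - ln t = e / 4 * (- ln t / (- ln t + 1)).
    by rewrite /r; field; rewrite gt_eqF//; lra.
  rewrite -[leRHS]mulr1 ler_pM2l// ler_pdivrMr ?mul1r; lra.
apply: (@le_trans _ _ (limn_esup (fun i =>
  (lne (#|good_models mu T phi W r (sigma i)|%:R)%:E * ((m i)%:R^-1)%:E)%E))).
  apply: (@le_trans _ _ (ereal_inf [set limn_esup (fun i =>
      (lne (#|good_models mu T phi W e' (sigma i)|%:R)%:E * ((m i)%:R^-1)%:E)%E)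
      | e' in [set e' : R | 0 < e']])).
    by apply: ereal_inf_lbound; exists W.
  by apply: ereal_inf_lbound; exists r.
apply: limn_esup_le_near; near=> i.
have m0 : (0 < m i)%N by near: i; exact: (near_size sigma_sofic).
have m0' : 0 < ((m i)%:R : R) by rewrite ltr0n.
have [/eqP G0|G0] := posnP #|good_models mu T phi W r (sigma i)|.
  by rewrite (eqP G0) le0_lneNy// mulNyr gtr0_sg ?invr_gt0// mul1e leNye.
have G0' : 0 < (#|good_models mu T phi W r (sigma i)|%:R : R) by rewrite ltr0n.
rewrite lne_EFin// -EFinM lee_fin ler_pdivrMr// -(ler_pM2l W0').
have := good_models_entropy_bound T_pmp phi_measurable m0 (_ : 0 < t <= 2^-1) G0.
rewrite t0 t2 => /(_ isT)/le_trans; apply.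
have cc : ln #|A|%:R * #|coincidences (sigma i) W|%:R <= e / 4 * (m i)%:R.
  rewrite -ler_pdivrMr// -mulrA; near: i.
  have bd0 : ln #|A|%:R * (#|coincidences (sigma i) W|%:R / (m i)%:R)
      @[i --> \oo] --> (0 : R).
    rewrite -[X in _ --> X](mulr0 (ln #|A|%:R)); apply: cvgMl_tmp.
    exact: cvg_coincidences.
  move/cvgr0Pnorm_le: bd0 => /(_ _ e4); apply: filterS => i.
  exact: ler_normlW.
apply: (@le_trans _ _ ((m i)%:R * ((min_rate mu T phi + e / 4) * #|` W|%:R +
    e / 4 * #|` W|%:R + e / 4 * #|` W|%:R) + #|` W|%:R * (e / 4 * (m i)%:R))).
  apply: lerD; last by rewrite ler_pM2l.
  rewrite ler_pM2l//; apply: lerD; first apply: lerD => //.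
    by apply: (le_trans Nt); rewrite ler_pMr.
  by apply: (le_trans rt); rewrite ler_pMr.
by rewrite le_eqVlt; apply/orP; left; apply/eqP; field.
Unshelve. all: by end_near. Qed.

End UpperLimit.

(** * Random priorities *)

Section MinHash.
Variable m : nat.
Implicit Types (pi : 'S_m) (U : {set 'I_m}).

Definition first_in pi U u := (u \in U) && [forall v in U, (pi u <= pi v)%N].

Lemma first_in_inj pi U u v : first_in pi U u -> first_in pi U v -> u = v.
Proof.
move=> /andP[uU /forall_inP hu] /andP[vU /forall_inP hv].
apply: (@perm_inj _ pi); apply: val_inj; apply/eqP.
by rewrite eqn_leq hu ?hv.
Qed.

Lemma first_in_exists pi U u : u \in U -> exists v, first_in pi U v.
Proof.
move=> uU; case: (arg_minnP (fun v => pi v : nat) uU) => v vU hv.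
by exists v; apply/andP; split => //; apply/forall_inP.
Qed.

(** Composition with the transposition of [u] and [v] exchanges the two sets of
    orders. *)
Lemma card_first_in_eq U u v : u \in U -> v \in U ->
  #|[set pi | first_in pi U u]%SET| = #|[set pi | first_in pi U v]%SET|.
Proof.
move=> uU vU; rewrite -(card_imset _ (@mulgI _ (tperm u v))).
have tU x : (tperm u v x \in U) = (x \in U).
  by case: tpermP => [->|->|//]; rewrite ?uU ?vU.
apply: eq_card => pi; rewrite inE; apply/imsetP/idP.
  move=> [rho + ->]; rewrite !inE => /andP[_ /forall_inP h].
  rewrite /first_in vU; apply/forall_inP => x xU.
  by rewrite !permM tpermR h// tU.
move=> /andP[_ /forall_inP h]; exists (tperm u v * pi)%g; last first.
  by rewrite mulgA tperm2 mul1g.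
rewrite inE /first_in uU; apply/forall_inP => x xU.
by rewrite !permM tpermL h// tU.
Qed.

Lemma card_first_in U u : u \in U ->
  (#|U| * #|[set pi | first_in pi U u]%SET|)%N = m`!.
Proof.
move=> uU; rewrite -[RHS]card_Sn -sum_nat_const.
rewrite (eq_bigr (fun v => #|[set pi | first_in pi U v]%SET|)); last first.
  by move=> v vU; exact: card_first_in_eq.
under eq_bigr do rewrite -sum1_card big_mkcond/=.
rewrite exchange_big/= -sum1_card; apply: eq_big => [pi|pi _]; first by rewrite inE.
have [v fv] := first_in_exists pi uU; have vU : v \in U by case/andP: fv.
rewrite (bigD1 v)//= inE fv big1// => w /andP[wU wv]; rewrite inE ifF//.
by apply: contraNF wv => fw; rewrite (first_in_inj fw fv).
Qed.

(** Stated without choosing the first elements of [U] and [V]: for nonempty sets it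
    says that they differ. *)
Definition separated pi U V := ~~ [exists u, first_in pi U u && first_in pi V u].

(** If the first element of [U :|: V] lies in both sets it is the first element of
    each. It is uniformly distributed in [U :|: V]. *)
Lemma card_separated U V u : u \in U ->
  (#|U :|: V| * #|[set pi | separated pi U V]%SET| <=
     #|(U :|: V) :\: (U :&: V)| * m`!)%N.
Proof.
move=> uU; set D := (_ :\: _)%SET.
have sepD : (#|[set pi | separated pi U V]%SET| <=
    \sum_(v in D) #|[set pi | first_in pi (U :|: V) v]%SET|)%N.
  rewrite -sum1_card big_mkcond/=.
  under [X in (_ <= X)%N]eq_bigr do rewrite -sum1_card big_mkcond/=.
  rewrite exchange_big/=; apply: leq_sum => pi _; rewrite inE.
  case: ifP => // sep.
  have uUV : u \in (U :|: V)%SET by rewrite inE uU.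
  have [v fv] := first_in_exists pi uUV.
  have /andP[vUV /forall_inP hv] := fv.
  suff vD : v \in D by rewrite (bigD1 v)//= inE fv.
  rewrite inE vUV andbT; apply: contraL sep; rewrite inE negbK => /andP[vU vV].
  apply/existsP; exists v; rewrite /first_in vU vV/=.
  by apply/andP; split; apply/forall_inP => x xU; apply: hv; rewrite inE xU ?orbT.
apply: leq_trans (leq_mul (leqnn _) sepD) _.
rewrite big_distrr/= -sum_nat_const; apply: leq_sum => v.
by rewrite inE => /andP[_ vUV]; rewrite card_first_in.
Qed.

End MinHash.

(** * Carving a sofic model into Folner pieces *)

Section Carving.
Variables (G : groupType) (m : nat) (s : G -> 'S_m) (W F : {fset G}).

(** The points [c] seen from which [s] looks like left multiplication on [F]:
    products [w f] are respected, and different elements of [F] or of [W F], one of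
    them in [F], move [c] to different points. *)
Definition regular (c : 'I_m) :=
  [&& [forall w : W, forall f : F,
    s (val w) (s (val f) c) == s (val w * val f)%g c],
      [forall f : F, forall f' : F, (s (val f) c == s (val f') c) ==> (f == f')]
    & [forall w : W, forall f : F, forall f' : F,
         (s (val f') c == s (val w * val f)%g c) ==> (val f' == val w * val f)%g]].

Lemma card_irregular :
  (#|[set c | ~~ regular c]%SET| <=
   \sum_(w : W) \sum_(f : F)
     #|[set c | s (val w) (s (val f) c) != s (val w * val f)%g c]%SET| +
   (\sum_(f : F) \sum_(f' : F)
     (f != f') * #|[set c | s (val f) c == s (val f') c]%SET| +
   \sum_(w : W) \sum_(f : F) \sum_(f' : F)
     (val f' != val w * val f)%g *
     #|[set c | s (val f') c == s (val w * val f)%g c]%SET|))%N.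
Proof.
have card_guard (b : bool) (Z : pred 'I_m) :
    #|[set c | Z c && b]%SET| = (b * #|[set c | Z c]%SET|)%N.
  case: b; first by rewrite mul1n; apply: eq_card => c; rewrite !inE andbT.
  by apply/eqP; rewrite cards_eq0; apply/eqP/finset.setP => c; rewrite !inE andbF.
apply: leq_trans (leq_add _ (leq_add _ _)); last first.
- apply: leq_sum => w _; apply: leq_sum => f _; apply: leq_sum => f' _.
  by rewrite -card_guard; apply: leqnn.
- by apply: leq_sum => f _; apply: leq_sum => f' _; rewrite -card_guard;
  apply: leqnn.
- by apply: leq_sum => w _; apply: leq_sum => f _; apply: leqnn.
apply: leq_trans (leq_add _ (leq_add _ _)); last first.
- apply: leq_sum => w _; apply: leq_sum => f _; exact: card_exists_le.
- apply: leq_sum => f _; exact: card_exists_le.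
- apply: leq_sum => w _; exact: card_exists_le.
apply: leq_trans (leq_add _ (leq_add _ _)); last first.
- apply: leq_sum => w _; exact: card_exists_le.
- exact: card_exists_le.
- exact: card_exists_le.
apply: leq_trans (leq_add _ (leq_add _ _)); last first.
- exact: card_exists_le.
- exact: leqnn.
- exact: leqnn.
apply: leq_trans (leq_add (leqnn _) (leq_card_setU _ _)).
apply: leq_trans (leq_card_setU _ _).
apply: subset_leq_card; apply/fintype.subsetP => c; rewrite !inE /regular !negb_and.
case/or3P; rewrite negb_forall => /existsP[x]; rewrite negb_forall => /existsP[y] h.
- by apply/orP; left; apply/existsP; exists x; apply/existsP; exists y.
- apply/orP; right; apply/orP; left; apply/existsP; exists x; apply/existsP;
  exists y.
  by rewrite -negb_imply.
- apply/orP; right; apply/orP; right; apply/existsP; exists x; apply/existsP;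
  exists y.
  by move: h; rewrite negb_forall => /existsP[z h]; apply/existsP; exists z;
    rewrite -negb_imply.
Qed.

Definition centers (p : 'I_m) : {set 'I_m} :=
  [set ((s (val f))^-1)%g p | f : F]%SET.

Lemma centersP (c p : 'I_m) :
  reflect (exists f : F, s (val f) c = p) (c \in centers p).
Proof.
apply: (iffP imsetP) => [[f _ ->]|[f <-]]; exists f; rewrite // ?permKV//.
by rewrite permK.
Qed.

Definition irregularly_covered : {set 'I_m} :=
  [set p | ~~ (centers p \subset [set c | regular c]%SET)]%SET.

Lemma card_irregularly_covered :
  (#|irregularly_covered| <= #|` F| * #|[set c | ~~ regular c]%SET|)%N.
Proof.
apply: (@leq_trans #|[set p | [exists f : F, p \in
    [set s (val f) c | c in [set c | ~~ regular c]]]]%SET|).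
  apply: subset_leq_card; apply/fintype.subsetP => p; rewrite !inE.
  move=> /subsetPn[c /centersP[f fc] cr]; apply/existsP; exists f.
  by apply/imsetP; exists c; rewrite // inE; move: cr; rewrite inE.
apply: leq_trans (card_exists_le _) _.
rewrite cardfE -sum_nat_const; apply: leq_sum => f _.
rewrite -(card_imset [set c | ~~ regular c]%SET (@perm_inj _ (s (val f)))).
by apply: subset_leq_card; apply/fintype.subsetP => p; rewrite inE.
Qed.

Definition exits (w : G) : {set F} := [set f : F | (w * val f)%g \notin F]%SET.

Lemma card_centers_le p : (#|centers p| <= #|` F|)%N.
Proof. by rewrite cardfE; exact: leq_imset_card. Qed.

Lemma center_inj p : p \notin irregularly_covered ->
  injective (fun f : F => ((s (val f))^-1)%g p).
Proof.
rewrite inE negbK => /fintype.subsetP reg f f' ff'.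
have : regular (((s (val f))^-1)%g p).
  by have := reg (((s (val f))^-1)%g p); rewrite inE; apply; apply/imsetP; exists f.
case/and3P => _ /forallP/(_ f)/forallP/(_ f')/implyP + _.
by rewrite permKV {1}ff' permKV eqxx => /(_ isT)/eqP.
Qed.

Lemma card_centers p : p \notin irregularly_covered -> #|centers p| = #|` F|.
Proof. by move=> /center_inj finj; rewrite card_imset// cardfE. Qed.

(** If [p = s f c] and [w f] is in [F], then [s w p = s (w f) c] has the centre [c]
    too. *)
Lemma card_centersI p (w : W) : p \notin irregularly_covered ->
  (#|` F| <= #|centers p :&: centers (s (val w) p)| + #|exits (val w)|)%N.
Proof.
move=> pr; rewrite cardfE -(cardsC (exits (val w))) addnC leq_add2r.
rewrite -(card_imset _ (center_inj pr)).
apply: subset_leq_card; apply/fintype.subsetP => _ /imsetP[f + ->].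
rewrite !inE negbK => wf; apply/andP; split; first by apply/imsetP; exists f.
apply/centersP; exists [` wf]%fset => /=.
move: pr; rewrite inE negbK => /fintype.subsetP/(_ (((s (val f))^-1)%g p)).
rewrite inE imset_f// => /(_ isT)/and3P[/forallP/(_ w)/forallP/(_ f)/eqP + _ _].
by rewrite permKV => <-.
Qed.

Lemma card_separated_centers p (w : W) :
    p \notin irregularly_covered -> F != fset0 ->
  (#|[set pi | separated pi (centers p) (centers (s (val w) p))]%SET| * #|` F| <=
     2 * #|exits (val w)| * m`!)%N.
Proof.
move=> pr /fset0Pn[f0 f0F].
have p0 : ((s f0)^-1)%g p \in centers p by apply/centersP; exists [` f0F]%fset;
  rewrite permKV.
have := card_separated (centers (s (val w) p)) p0.
set U := centers p; set V := centers _ => sepUV.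
have FU : (#|` F| <= #|U :|: V|)%N.
  by rewrite -(card_centers pr) subset_leq_card// finset.subsetUl.
rewrite mulnC; apply: leq_trans (leq_mul FU (leqnn _)) _.
apply: leq_trans sepUV _; rewrite leq_mul2r; apply/orP; right.
have IU : (U :&: V \subset U :|: V)%SET.
  by apply: (fintype.subset_trans (finset.subsetIl U V)); exact: finset.subsetUl.
have := cardsUI U V; have := card_centersI w pr; have := card_centers pr.
have := card_centers_le (s (val w) p); rewrite -/U -/V.
have := cardsID (U :&: V)%SET (U :|: V)%SET; rewrite (finset.setIidPr IU).
by move=> *; lia.
Qed.

(** Inside the piece of centre [c p], whose points are named by elements of [F],
    the map [s w] acts at [p] as left multiplication by [w]. *)
Definition well_placed (c : 'I_m -> 'I_m) (f : 'I_m -> F) (p : 'I_m) :=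
  [forall w : W, (c (s (val w) p) == c p) &&
     (val (f (s (val w) p)) == val w * val (f p))%g].

Lemma well_placedP c f p :
  reflect (forall w : W, c (s (val w) p) = c p /\
      val (f (s (val w) p)) = (val w * val (f p))%g)
    (well_placed c f p).
Proof.
apply: (iffP forallP) => h w; first by have /andP[/eqP ? /eqP ?] := h w.
by have [-> ->] := h w; rewrite !eqxx.
Qed.

(** Averaging [card_separated_centers] over all points and all orders gives an
    order under which few points are separated from one of their [W]-neighbours.
    At the remaining points the centres agree, and regularity of the common centre
    makes the names agree. *)
Lemma exists_carving : F != fset0 ->
  exists (c : 'I_m -> 'I_m) (f : 'I_m -> F),
    (forall p, s (val (f p)) (c p) = p) /\
    (#|` F| * #|[set p | ~~ well_placed c f p]%SET| <=
     #|` F| * (#|` F| * #|[set c | ~~ regular c]%SET|) +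
     m * \sum_(w : W) 2 * #|exits (val w)|)%N.
Proof.
move=> F0.
pose sep (pi : 'S_m) p (w : W) := separated pi (centers p) (centers (s (val w) p)).
pose B pi := [set p | (p \notin irregularly_covered) && [exists w, sep pi p w]]%SET.
(* Otherwise the sum over all orders of the number of separated points would
   exceed the bound given by [card_separated_centers]. *)
have [pi Bpi] : exists pi,
  (#|B pi| * #|` F| <= m * \sum_(w : W) 2 * #|exits (val w)|)%N.
  apply/existsP; apply: contraT; rewrite negb_exists => /forallP Bbig.
  have : (\sum_(pi : 'S_m) (m * \sum_(w : W) 2 * #|exits (val w)|).+1 <=
      \sum_(pi : 'S_m) #|B pi| * #|` F|)%N.
    by apply: leq_sum => pi _; rewrite ltnNge Bbig.
  rewrite -big_distrl/= sum_nat_const.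
  rewrite card_Sn.
  have : (\sum_(pi : 'S_m) #|B pi| * #|` F| <=
      \sum_(p < m) \sum_(w : W) 2 * #|exits (val w)| * m`!)%N.
    apply: (@leq_trans (\sum_(p < m) \sum_(w : W)
      (p \notin irregularly_covered) * (#|[set pi | sep pi p w]%SET| * #|` F|))%N).
      rewrite -big_distrl/=.
      under eq_bigr do rewrite -sum1_card big_mkcond/=.
      rewrite exchange_big/= big_distrl/=; apply: leq_sum => p _.
      under eq_bigr do rewrite inE.
      case: (p \in irregularly_covered) => /=; first by rewrite big1.
      under [X in (_ <= X)%N]eq_bigr do rewrite mul1n.
      rewrite -big_distrl/= leq_mul2r; apply/orP; right.
      rewrite -big_mkcond/= sum1_card.
      have := card_exists_le (fun w => [pred pi | sep pi p w]).
      apply: leq_trans; apply: subset_leq_card; apply/fintype.subsetP => pi.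
      by rewrite !inE.
    apply: leq_sum => p _; apply: leq_sum => w _.
    by case: (boolP (p \in irregularly_covered)) => //= pr;
      rewrite mul1n card_separated_centers.
  rewrite sum_nat_const card_ord -!big_distrl/= => h1 /leq_trans/(_ h1).
  by have := fact_gt0 m; nia.
have cf p : exists cf : 'I_m * F,
    first_in pi (centers p) cf.1 /\ s (val cf.2) cf.1 = p.
  have [f0 f0F] := fset0Pn _ F0.
  have p0 : ((s f0)^-1)%g p \in centers p by apply/centersP; exists [` f0F]%fset;
    rewrite permKV.
  have [c cp] := first_in_exists pi p0; have /andP[/centersP[f fp] _] := cp.
  by exists (c, f).
have [g gP] := fin_all_exists cf.
exists (fun p => (g p).1), (fun p => (g p).2); split; first by move=> p;
  case: (gP p).
apply: (@leq_trans (#|` F| * (#|irregularly_covered| + #|B pi|))%N); last first.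
  by rewrite mulnDr leq_add// ?leq_mul2l ?card_irregularly_covered ?orbT// mulnC.
rewrite leq_mul2l; apply/orP; right.
apply: leq_trans (leq_card_setU _ _).
apply: subset_leq_card; apply/fintype.subsetP => p;
  rewrite [p \in [set _ | _]%SET]inE => pbad.
rewrite inE; apply/orP; case: (boolP (p \in irregularly_covered)) => pr;
  [by left|right].
rewrite inE pr/=; apply: contraR pbad; rewrite negb_exists => /forallP nosep.
apply/forallP => w; have := nosep w; rewrite negbK => /existsP[u /andP[u1 u2]].
have [g1 g2] := gP p; have [h1 h2] := gP (s (val w) p).
rewrite (first_in_inj h1 u2) (first_in_inj g1 u1) eqxx/=.
have ereg : regular u.
  move: pr; rewrite inE negbK => /fintype.subsetP/(_ u); rewrite inE; apply.
  by case/andP: u1.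
case/and3P: ereg => /forallP/(_ w)/forallP/(_ (g p).2)/eqP r1 _.
move=> /forallP/(_ w)/forallP/(_ (g p).2)/forallP/(_ (g (s (val w) p)).2)/implyP;
  apply.
rewrite -r1 -{1}(first_in_inj h1 u2) h2.
by rewrite -(first_in_inj g1 u1) g2.
Qed.

End Carving.

Section CarvingDefects.
Variables (R : realType) (G : groupType) (m : nat -> nat).
Variable sigma : forall i, G -> 'S_(m i).
Hypothesis sigma_sofic : sofic_approximation R sigma.

Lemma cvg_irregular (W F : {fset G}) :
  (#|[set c | ~~ regular (sigma i) W F c]%SET|%:R / (m i)%:R : R)
    @[i --> \oo] --> (0 : R).
Proof.
pose bd1 i : R := \sum_(w : W) \sum_(f : F)
  #|[set c | sigma i (val w) (sigma i (val f) c) != sigma i (val w * val f)%g c]%SET|%:R / (m i)%:R.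
pose bd2 i : R := \sum_(f : F) \sum_(f' : F) (f != f')%:R *
   (#|[set c | sigma i (val f) c == sigma i (val f') c]%SET|%:R / (m i)%:R).
pose bd3 i : R := \sum_(w : W) \sum_(f : F) \sum_(f' : F)
  (val f' != val w * val f)%g%:R *
  (#|[set c | sigma i (val f') c == sigma i (val w * val f)%g c]%SET|%:R
    / (m i)%:R).
have free0 (g h : G) (b : bool) : (b -> g != h) ->
  (b%:R * (#|[set c | sigma i g c == sigma i h c]%SET|%:R / (m i)%:R) : R)
    @[i --> \oo] --> (0 : R).
  case: b => [/(_ isT) gh|_].
    by under eq_fun do rewrite mul1r; exact: (cvg_free_defect sigma_sofic gh).
  by under eq_fun do rewrite mul0r; exact: cvg_cst.
have bd10 : bd1 i @[i --> \oo] --> (0 : R).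
  apply: cvg_sum0 => w; apply: cvg_sum0 => f.
  exact: (cvg_mult_defect sigma_sofic).
have bd20 : bd2 i @[i --> \oo] --> (0 : R).
  by apply: cvg_sum0 => f; apply: cvg_sum0 => f'; apply: free0.
have bd30 : bd3 i @[i --> \oo] --> (0 : R).
  by apply: cvg_sum0 => w; apply: cvg_sum0 => f; apply: cvg_sum0 => f';
    apply: free0.
have bd0 : bd1 i + (bd2 i + bd3 i) @[i --> \oo] --> (0 : R).
  have h := cvgD bd10 (cvgD bd20 bd30); rewrite !addr0 in h; exact: h.
apply: (@squeeze_cvgr _ _ _ _ (fun=> 0) (fun i => bd1 i + (bd2 i + bd3 i))) => //;
  last exact: cvg_cst.
near=> i; rewrite divr_ge0//=.
have irr := card_irregular (sigma i) W F; rewrite -(ler_nat R) in irr.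
have mV : 0 <= (m i)%:R^-1 :> R by rewrite invr_ge0.
apply: le_trans (ler_wpM2r mV irr) _.
rewrite !natrD !mulrDl; apply: lerD; last apply: lerD.
- rewrite natr_sum mulr_suml; apply: ler_sum => w _.
  by rewrite natr_sum mulr_suml; apply: ler_sum.
- rewrite natr_sum mulr_suml; apply: ler_sum => f _.
  by rewrite natr_sum mulr_suml; apply: ler_sum => f' _; rewrite natrM mulrA.
- rewrite natr_sum mulr_suml; apply: ler_sum => w _.
  rewrite natr_sum mulr_suml; apply: ler_sum => f _.
  by rewrite natr_sum mulr_suml; apply: ler_sum => f' _; rewrite natrM mulrA.
Unshelve. all: by end_near. Qed.

Lemma cvg_exits (F : nat -> {fset G}) (w : G) : left_folner R F ->
  (#|exits (F n) w|%:R / #|` F n|%:R : R) @[n --> \oo] --> (0 : R).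
Proof.
move=> [F0 F_inv]; apply: (@squeeze_cvgr _ _ _ _ (fun=> 0) _ _ _ _ _
  (F_inv w^-1%g)).
  near=> n; rewrite divr_ge0//= ler_wpM2r ?invr_ge0// ler_nat.
  by have := card_outside_translate (F n) w^-1%g; rewrite invgK.
exact: cvg_cst.
Unshelve. all: by end_near. Qed.

End CarvingDefects.

(** * Independent pieces *)

Section ProductLaw.
Variables (R : realType) (I B : finType) (P : B -> R).
Hypothesis P_ge0 : forall b, 0 <= P b.
Hypothesis P_sum1 : \sum_b P b = 1.

Definition product_law (o : {ffun I -> B}) : R := \prod_i P (o i).

Lemma product_law_ge0 o : 0 <= product_law o.
Proof. exact: prodr_ge0. Qed.

Lemma sum_product_law (g : I -> B -> R) :
  \sum_o product_law o * \prod_i g i (o i) = \prod_i \sum_b P b * g i b.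
Proof.
rewrite bigA_distr_bigA/=; apply: eq_bigr => o _.
by rewrite /product_law -big_split.
Qed.

Lemma sum_product_law1 : \sum_o product_law o = 1.
Proof. by rewrite -(bigA_distr_bigA (fun=> P)) big1. Qed.

Lemma sum_product_law_coord (i : I) (u : B -> R) :
  \sum_o product_law o * u (o i) = \sum_b P b * u b.
Proof.
pose g j b := if j == i then u b else 1.
have gE (o : {ffun I -> B}) : u (o i) = \prod_j g j (o j).
  by rewrite (bigD1 i)//= /g eqxx big1 ?mulr1// => j /negbTE ->.
under eq_bigr do rewrite gE.
rewrite sum_product_law (bigD1 i)//= /g eqxx [X in _ * X]big1 ?mulr1// =>
  j /negbTE ->.
by under eq_bigr do rewrite mulr1.
Qed.

Lemma sum_product_law_coord2 (i j : I) (u v : B -> R) : i != j ->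
  \sum_o product_law o * (u (o i) * v (o j)) =
  (\sum_b P b * u b) * (\sum_b P b * v b).
Proof.
move=> ij; have ji : j != i by rewrite eq_sym.
pose g k b := if k == i then u b else if k == j then v b else 1.
have gE (o : {ffun I -> B}) : u (o i) * v (o j) = \prod_k g k (o k).
  rewrite (bigD1 i)//= (bigD1 j)//= /g eqxx (negbTE ji) eqxx.
  by rewrite big1 ?mulr1// => k /andP[/negbTE -> /negbTE ->].
under eq_bigr do rewrite gE.
rewrite sum_product_law (bigD1 i)//= (bigD1 j)//= /g eqxx (negbTE ji) eqxx.
rewrite [X in _ * (_ * X)]big1 ?mulr1// => k /andP[/negbTE -> /negbTE ->].
by under eq_bigr do rewrite mulr1.
Qed.

(** In the expansion of the square, a pair of points in different tiles contributes
    [0] by independence, and a pair in the same tile at most [1]. *)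
Lemma tile_variance (J : finType) (c : J -> I) (y : J -> B -> R) (K : nat) :
    (forall p, \sum_b P b * y p b = 0) ->
    (forall p b, `|y p b| <= 1) ->
    (forall p, #|[set p' | c p' == c p]%SET| <= K)%N ->
  \sum_o product_law o * (\sum_p y p (o (c p))) ^+ 2 <= #|J|%:R * K%:R.
Proof.
move=> y0 y1 cK.
have -> : \sum_o product_law o * (\sum_p y p (o (c p))) ^+ 2 =
    \sum_p \sum_p' \sum_o product_law o * (y p (o (c p)) * y p' (o (c p'))).
  under eq_bigr do rewrite expr2 big_distrlr/= mulr_sumr.
  rewrite exchange_big/=; apply: eq_bigr => p _.
  under eq_bigr do rewrite mulr_sumr.
  by rewrite exchange_big.
have -> : #|J|%:R * K%:R = \sum_(p : J) K%:R :> R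
  by rewrite sumr_const -(mulr_natl K%:R).
apply: ler_sum => p _.
apply: (@le_trans _ _ (\sum_p' (c p' == c p)%:R)); last first.
  apply: (@le_trans _ _ (#|[set p' | c p' == c p]%SET|%:R));
    last by rewrite ler_nat.
  rewrite -sum1_card natr_sum [leRHS]big_mkcond/=; apply: ler_sum => p' _.
  by rewrite inE; case: ifP.
apply: ler_sum => p' _; have [cc|cc] := eqVneq (c p') (c p).
  rewrite -sum_product_law1; apply: ler_sum => o _.
  rewrite -[leRHS]mulr1 ler_wpM2l ?product_law_ge0//.
  apply: le_trans (ler_norm _) _; rewrite normrM -[leRHS]mulr1.
  by rewrite ler_pM.
by rewrite sum_product_law_coord2 1?eq_sym// y0 mul0r.
Qed.

End ProductLaw.

Lemma ln_prod (R : realType) (I : finType) (u : I -> R) :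
  (forall i, 0 < u i) -> ln (\prod_i u i) = \sum_i ln (u i).
Proof.
move=> u0; suff : 0 < \prod_i u i /\ ln (\prod_i u i) = \sum_i ln (u i) by case.
elim/big_ind2 : _ => [|x x' y y' [x0 xE] [y0 yE]|i _]; first by rewrite ln1.
  by rewrite mulr_gt0// lnM ?posrE// xE yE.
by split.
Qed.

Section ProductEntropy.
Variables (R : realType) (I L J A : finType) (P : {ffun L -> A} -> R).
Hypothesis P_ge0 : forall b, 0 <= P b.
Hypothesis P_sum1 : \sum_b P b = 1.
Variables (c : J -> I) (f : J -> L).

Definition assemble (o : {ffun I -> {ffun L -> A}}) : {ffun J -> A} :=
  [ffun p => o (c p) (f p)].

Definition labels (i : I) : {set L} := [set f p | p in [set p | c p == i]]%SET.

Lemma assembleP (o o' : {ffun I -> {ffun L -> A}}) :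
  (assemble o' == assemble o) =
  [forall i, restr (labels i) (o' i) == restr (labels i) (o i)].
Proof.
apply/eqP/forallP => [/ffunP eqo i|eqo].
  apply/eqP/restrP => l /imsetP[p + ->]; rewrite inE => /eqP ip.
  by have := eqo p; rewrite !ffunE ip.
apply/ffunP => p; rewrite !ffunE.
have /eqP/restrP := eqo (c p); apply.
by apply/imsetP; exists p; rewrite ?inE.
Qed.

(** Two families of patterns assemble to the same labelling when they agree on the
    labels in use, a condition on each piece separately. *)
Lemma law_assemble (o : {ffun I -> {ffun L -> A}}) :
  law (product_law (I := I) P) assemble (assemble o) =
  \prod_i law P (restr (labels i)) (restr (labels i) (o i)).
Proof.
rewrite /law bigA_distr_big_dep/=; apply: eq_bigl => x.
by rewrite assembleP.
Qed.

Lemma entropy_assemble :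
  entropy (product_law (I := I) P) assemble = \sum_i entropy P (restr (labels i)).
Proof.
rewrite entropyE.
have -> : \sum_o product_law P o *
      ln (law (product_law (I := I) P) assemble (assemble o)) =
    \sum_o \sum_i product_law P o *
      ln (law P (restr (labels i)) (restr (labels i) (o i))).
  apply: eq_bigr => o _; have [->|Qo] := eqVneq (product_law P o) 0.
    by rewrite mul0r big1// => i _; rewrite mul0r.
  rewrite law_assemble ln_prod ?mulr_sumr// => i.
  apply: lt_le_trans (le_law P_ge0 _ _).
  rewrite lt_neqAle P_ge0 andbT eq_sym; apply: contra_neq Qo => Poi.
  by rewrite /product_law (bigD1 i)//= Poi mul0r.
rewrite exchange_big/= -sumrN; apply: eq_bigr => i _; rewrite entropyE.
by rewrite (sum_product_law_coord P_sum1 i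
  (fun b => ln (law P (restr (labels i)) (restr (labels i) b)))).
Qed.

End ProductEntropy.

(** * Lower bound for the number of good models *)

Section LowerBound.
Variables (R : realType) (G : groupType) (A : finType).
Variables (d : measure_display) (X : measurableType d).
Variables (mu : probability X R) (T : G -> X -> X) (phi : X -> A).
Hypothesis T_pmp : pmp_action mu T.
Hypothesis phi_measurable : forall B : set A, measurable (phi @^-1` B).
Local Notation plaw W := (@pattern_law R G A d X mu T phi W).
Local Notation H W := (shannon_entropy (plaw W)).

Section FixedCarving.
Variables (m : nat) (s : G -> 'S_m) (W F : {fset G}).
Variables (c : 'I_m -> 'I_m) (f : 'I_m -> F).
Hypothesis cfK : forall p, s (val (f p)) (c p) = p.
Hypothesis m_gt0 : (0 < m)%N.
Local Notation good p := (well_placed s W c f p).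
Local Notation bad := [set p | ~~ well_placed s W c f p]%SET.
Local Notation Q := (product_law (I := 'I_m) (plaw F)).
Local Notation N := (#|{ffun W -> A}|%:R : R).

Let P0 := pattern_law_ge0 mu T phi (W := F).
Let P1 := sum_pattern_law T_pmp phi_measurable F.

Lemma carving_inj p p' : c p = c p' -> f p = f p' -> p = p'.
Proof. by move=> cc ff; rewrite -(cfK p) -(cfK p') cc ff. Qed.

Lemma card_labels i : #|labels c f i| = #|[set p | c p == i]%SET|.
Proof.
apply: card_in_imset => p p'; rewrite !inE => /eqP pi /eqP pi'.
by apply: carving_inj; rewrite pi pi'.
Qed.

(** The points of the piece [i] have distinct names, so it contributes
    [min_rate] times its size, and the pieces partition the [m] points. *)
Lemma entropy_assemble_ge :
  m%:R * min_rate mu T phi <= entropy Q (assemble (A := A) c f).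
Proof.
rewrite entropy_assemble//.
apply: (@le_trans _ _ (\sum_i min_rate mu T phi * #|labels c f i|%:R)); last first.
  by apply: ler_sum => i _; exact: pattern_entropy_subrate.
rewrite -mulr_sumr mulrC -natr_sum; under eq_bigr do rewrite card_labels.
suff -> : (\sum_i #|[set p | c p == i]%SET| = m)%N by [].
transitivity (\sum_(p < m) 1)%N; last by rewrite sum_nat_const card_ord muln1.
rewrite [RHS](partition_big c predT)//=.
by apply: eq_bigr => i _; rewrite -sum1_card; apply: eq_bigl => p; rewrite inE.
Qed.

(** Set to zero at badly placed points, whose pattern may involve several pieces,
    so that the deviation at [p] is a centred function of the piece of [p] alone. *)
Definition deviation (a : {ffun W -> A}) (p : 'I_m) (eta : {ffun F -> A}) : R :=
  if good p then ([ffun w : W => eta (f (s (val w) p))] == a)%:R - plaw W a else 0.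

Lemma sum_deviation a p : \sum_eta plaw F eta * deviation a p eta = 0.
Proof.
rewrite /deviation; have [/well_placedP gp|_] := boolP (good p); last first.
  by rewrite big1// => eta _; rewrite mulr0.
under eq_bigr do rewrite mulrBr; rewrite sumrB -mulr_suml P1 mul1r.
apply/eqP; rewrite subr_eq0; apply/eqP.
rewrite -(pattern_law_translate T_pmp phi_measurable (c := val (f p))
  (u := fun w => f (s (val w) p))) => [|w]; last by case: (gp w).
rewrite /law [RHS]big_mkcond; apply: eq_bigr => eta _.
by case: ifP; rewrite ?mulr1 ?mulr0.
Qed.

Lemma indicator_dist (b : bool) (a : {ffun W -> A}) : `|b%:R - plaw W a| <= 1.
Proof.
have a0 := pattern_law_ge0 mu T phi a.
have a1 : plaw W a <= 1.
  rewrite -(sum_pattern_law T_pmp phi_measurable W) (bigD1 a)//= lerDl.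
  by apply: sumr_ge0 => a' _; exact: pattern_law_ge0.
by rewrite ler_norml; case: b => /=; lra.
Qed.

Lemma deviation_le1 a p eta : `|deviation a p eta| <= 1.
Proof.
by rewrite /deviation; case: ifP => _; [exact: indicator_dist|rewrite normr0].
Qed.

Lemma deviation_variance a :
  \sum_o Q o * (\sum_p deviation a p (o (c p))) ^+ 2 <= m%:R * #|` F|%:R.
Proof.
rewrite -[X in X%:R * _]card_ord; apply: tile_variance => //.
- exact: sum_deviation.
- exact: deviation_le1.
move=> p; rewrite cardfE.
rewrite -(@card_in_imset _ _ f); first exact: max_card.
by move=> x y; rewrite !inE => /eqP cx /eqP cy; apply: carving_inj; rewrite cx.
Qed.

Lemma model_law_deviation a (o : {ffun 'I_m -> {ffun F -> A}}) :
  m%:R * `|plaw W a - model_law R s (assemble c f o) a| <=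
    `|\sum_p deviation a p (o (c p))| + #|bad|%:R.
Proof.
have m0 : 0 < (m%:R : R) by rewrite ltr0n.
pose hit p : bool := model_pattern s (assemble c f o) W p == a.
have -> : m%:R * `|plaw W a - model_law R s (assemble c f o) a| =
    `|\sum_p ((hit p)%:R - plaw W a)|.
  rewrite -[X in X * _](ger0_norm (ltW m0)) -normrM mulrBr distrC sumrB.
  rewrite sumr_const card_ord -(mulr_natl (plaw W a)) /model_law.
  rewrite mulrCA mulfV ?gt_eqF// mulr1; congr (`|_ - _|).
  rewrite -sum1_card natr_sum big_mkcond/=; apply: eq_bigr => p _.
  by rewrite inE /hit; case: eqP.
have -> : \sum_p ((hit p)%:R - plaw W a) = \sum_p deviation a p (o (c p)) +
    \sum_(p in bad) ((hit p)%:R - plaw W a).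
  rewrite [X in _ = _ + X]big_mkcond/= -big_split/=; apply: eq_bigr => p _.
  rewrite inE /deviation; case: ifPn => [/well_placedP gp|_] /=;
    last by rewrite add0r.
  rewrite addr0 /hit; congr ((_ == _)%:R - _).
  apply/ffunP => w; rewrite !ffunE.
  by have [-> _] := gp w.
apply: le_trans (ler_normD _ _) _; rewrite lerD2l.
apply: le_trans (ler_norm_sum _ _ _) _.
rewrite -sum1_card natr_sum; apply: ler_sum => p _.
exact: indicator_dist.
Qed.

Variable e : R.
Hypothesis e_gt0 : 0 < e.
Hypothesis few_bad : N * #|bad|%:R <= e * m%:R.
Local Notation Gam := (good_models mu T phi W e s).

(** A bad labelling is off by [2 * e] in total, of which the badly placed points
    explain at most [e]; so one of the [N] patterns has a deviation of at least
    [e * m / N]. *)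
Lemma not_good_deviation (o : {ffun 'I_m -> {ffun F -> A}}) :
  assemble c f o \notin Gam ->
  1 <= \sum_a (N / (e * m%:R)) ^+ 2 * (\sum_p deviation a p (o (c p))) ^+ 2.
Proof.
rewrite inE -leNgt /pattern_dist => far.
have m0 : 0 < (m%:R : R) by rewrite ltr0n.
have em0 : 0 < e * m%:R by rewrite mulr_gt0.
pose Y a := \sum_p deviation a p (o (c p)).
have sumY : e * m%:R <= \sum_a `|Y a|.
  have : \sum_a m%:R * `|plaw W a - model_law R s (assemble c f o) a| <=
      \sum_a (`|Y a| + #|bad|%:R).
    by apply: ler_sum => a _; exact: model_law_deviation.
  rewrite big_split/= sumr_const -(mulr_natl #|bad|%:R) -mulr_sumr.
  have : m%:R * (2 * e) <=
      m%:R * \sum_a `|plaw W a - model_law R s (assemble c f o) a|.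
    by rewrite ler_pM2l//; lra.
  move: few_bad; lra.
have [a aY] : exists a, e * m%:R <= N * `|Y a|.
  apply/existsP; apply: contraT; rewrite negb_exists => /forallP small.
  have : \sum_a N * `|Y a| < \sum_(a : {ffun W -> A}) e * m%:R.
    apply: ltr_sum => [|a _]; last by rewrite ltNge small.
    apply/hasP; have [a _|none] := pickP (@predT {ffun W -> A}).
      by exists a => //; exact: mem_index_enum.
    move: sumY; rewrite big_pred0 => [|a]; last by have := none a.
    by rewrite leNgt em0.
  rewrite -mulr_sumr sumr_const -(mulr_natl (e * _)) ltNge => /negP[].
  by rewrite ler_wpM2l.
rewrite (bigD1 a)//= -exprMn; apply: ler_wpDr.
  by apply: sumr_ge0 => a' _; rewrite mulr_ge0 ?sqr_ge0.
rewrite -/(Y a) -(real_normK (num_real _)) -[leLHS](expr1n _ 2) ler_pXn2r ?nnegrE//.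
rewrite normrM ger0_norm; last by rewrite divr_ge0// ltW.
by rewrite mulrAC ler_pdivlMr// mul1r.
Qed.

Lemma not_good_law :
  \sum_(psi | psi \notin Gam) law Q (assemble c f) psi <=
    N ^+ 3 * #|` F|%:R / e ^+ 2 / m%:R.
Proof.
have m0 : 0 < (m%:R : R) by rewrite ltr0n.
have -> : \sum_(psi | psi \notin Gam) law Q (assemble c f) psi =
    \sum_o Q o * (assemble c f o \notin Gam)%:R.
  rewrite -(sum_law_comp Q (assemble c f) (fun psi => (psi \notin Gam)%:R)).
  by rewrite big_mkcond; apply: eq_bigr => psi _; case: ifP; rewrite ?mulr1 ?mulr0.
apply: (@le_trans _ _ (\sum_o Q o * \sum_a (N / (e * m%:R)) ^+ 2 *
   (\sum_p deviation a p (o (c p))) ^+ 2)).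
  apply: ler_sum => o _; rewrite ler_wpM2l ?product_law_ge0//.
  case: (boolP (assemble c f o \notin Gam)) => [/not_good_deviation//|_].
  by apply: sumr_ge0 => a _; rewrite mulr_ge0 ?sqr_ge0.
under eq_bigr do rewrite mulr_sumr; rewrite exchange_big/=.
apply: (@le_trans _ _ (\sum_(a : {ffun W -> A})
    (N / (e * m%:R)) ^+ 2 * (m%:R * #|` F|%:R))).
  apply: ler_sum => a _; under eq_bigr do rewrite mulrCA.
  by rewrite -mulr_sumr ler_wpM2l ?sqr_ge0// deviation_variance.
rewrite sumr_const -(mulr_natl (_ ^+ 2 * _)) le_eqVlt; apply/orP; left; apply/eqP.
by field; rewrite !gt_eqF.
Qed.

Lemma good_models_lower_bound :
    N ^+ 3 * #|` F|%:R / e ^+ 2 < m%:R ->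
  (0 < #|Gam|)%N /\
  m%:R * min_rate mu T phi <= ln 2 + ln #|Gam|%:R +
     N ^+ 3 * #|` F|%:R / e ^+ 2 * ln #|A|%:R.
Proof.
move=> m_big; have m0 : 0 < (m%:R : R) by rewrite ltr0n.
have Q0 o : 0 <= Q o by exact: product_law_ge0.
have Q1 : \sum_o Q o = 1 by exact: sum_product_law1.
have notG := not_good_law.
have G0 : (0 < #|Gam|)%N.
  rewrite lt0n; apply/negP => /eqP/eqP; rewrite cards_eq0 => /eqP GE.
  have : \sum_(psi | psi \notin Gam) law Q (assemble c f) psi = 1.
    rewrite (eq_bigl predT) ?sum_law// => psi.
    by rewrite GE inE.
  move=> sum1; move: notG; rewrite sum1 leNgt ltr_pdivrMr// mul1r.
  by rewrite m_big.
split => //; apply: (le_trans entropy_assemble_ge).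
apply: (le_trans (entropy_le_good Q0 Q1 (assemble c f) G0)); rewrite lerD2l.
have A0 : (0 < #|A|)%N.
  have /card_gt0P[psi _] := G0.
  by apply/card_gt0P; exists (psi (Ordinal m_gt0)).
rewrite card_ffun card_ord natrX lnXn ?ltr0n//.
apply: (@le_trans _ _ (N ^+ 3 * #|` F|%:R / e ^+ 2 / m%:R * (ln #|A|%:R *+ m))).
  by rewrite ler_wpM2r// mulrn_wge0// ln_ge0// ler1n.
rewrite -(mulr_natl (ln _)) mulrA mulfVK ?gt_eqF//.
Qed.

End FixedCarving.
End LowerBound.

Section LowerLimit.
Variables (R : realType) (G : groupType) (A : finType).
Variables (d : measure_display) (X : measurableType d).
Variables (mu : probability X R) (T : G -> X -> X) (phi : X -> A).
Hypothesis T_pmp : pmp_action mu T.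
Hypothesis phi_measurable : forall B : set A, measurable (phi @^-1` B).
Variables (m : nat -> nat) (sigma : forall i, G -> 'S_(m i)).
Hypothesis sigma_sofic : sofic_approximation R sigma.

Lemma sofic_entropy_rate_ge (F : nat -> {fset G}) : left_folner R F ->
  ((min_rate mu T phi)%:E <= sofic_entropy_rate mu T phi sigma)%E.
Proof.
move=> F_folner; have [F0 _] := F_folner.
apply: le_ereal_inf_tmp => _ [W _ <-]; apply: le_ereal_inf_tmp => _ [e e0 <-].
have {}e0 : 0 < e := e0.
apply/lee_subgt0Pr => r r0; rewrite -EFinB.
pose N : R := #|{ffun W -> A}|%:R.
have e2 : 0 < e / 2 by rewrite divr_gt0.
(* The set [F n] is fixed first, from the tolerance [e / 2] for separated points;
   then the size of the model absorbs every quantity that depends on it. *)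
have [n nP] : exists n,
  N * (\sum_(w : W) 2 * (#|exits (F n) (val w)|%:R / #|` F n|%:R)) <= e / 2.
  have lim0 : N * (\sum_(w : W) 2 * (#|exits (F n) (val w)|%:R / #|` F n|%:R))
      @[n --> \oo] --> (0 : R).
    rewrite -[X in _ --> X](mulr0 N); apply: cvgMl_tmp; apply: cvg_sum0 => w.
    rewrite -[X in _ --> X](mulr0 2); apply: cvgMl_tmp; exact: cvg_exits.
  move/cvgr0Pnorm_le: lim0 => /(_ _ e2)/filter_ex[n nP]; exists n.
  exact: le_trans (ler_norm _) nP.
set E := F n in nP; have E0 : 0 < (#|` E|%:R : R) by rewrite ltr0n cardfs_gt0 F0.
pose b : R := N ^+ 3 * #|` E|%:R / e ^+ 2.
pose C : R := ln 2 + b * ln #|A|%:R.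
apply: limn_esup_ge_near; near=> i.
have m0 : (0 < m i)%N by near: i; exact: (near_size sigma_sofic).
have m0' : 0 < ((m i)%:R : R) by rewrite ltr0n.
have [c [f [cfK bad]]] := exists_carving (sigma i) W (F0 n).
have few_bad : N * #|[set p | ~~ well_placed (sigma i) W c f p]%SET|%:R <=
  e * (m i)%:R.
  have irr : N * #|` E|%:R *
      (#|[set c | ~~ regular (sigma i) W E c]%SET|%:R / (m i)%:R) <= e / 2.
    near: i; have lim0 : N * #|` E|%:R *
        (#|[set c | ~~ regular (sigma i) W E c]%SET|%:R / (m i)%:R)
        @[i --> \oo] --> (0 : R).
      rewrite -[X in _ --> X](mulr0 (N * #|` E|%:R)); apply: cvgMl_tmp.
      exact: (cvg_irregular sigma_sofic).
    move/cvgr0Pnorm_le: lim0 => /(_ _ e2); apply: filterS => j.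
    exact: ler_normlW.
  move: bad; rewrite -/E -(ler_nat R) !(natrD, natrM) natr_sum => bad.
  rewrite -(ler_pM2l E0) mulrCA; apply: le_trans (ler_wpM2l (ler0n _ _) bad) _.
  rewrite mulrDr; have -> : #|` E|%:R * (e * (m i)%:R) =
    #|` E|%:R * (e / 2 * (m i)%:R) + #|` E|%:R * (e / 2 * (m i)%:R) :> R by field.
  apply: lerD.
    rewrite mulrCA ler_pM2l// mulrA -ler_pdivrMr// -[leLHS]mulrA.
    exact: irr.
  move: nP; rewrite -mulr_sumr.
  have -> : \sum_(w : W) #|exits E (val w)|%:R / #|` E|%:R =
    (\sum_(w : W) #|exits E (val w)|%:R) / #|` E|%:R :> R by rewrite mulr_suml.
  rewrite !mulrA ler_pdivrMr// => nP.
  have -> : \sum_(w : W) (2 * #|exits E (val w)|)%N%:R =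
     2 * \sum_(w : W) #|exits E (val w)|%:R :> R.
    by rewrite mulr_sumr; apply: eq_bigr => w _; rewrite natrM.
  have := ler_wpM2r (ltW m0') nP; lra.
have [|G0 lo] := good_models_lower_bound T_pmp phi_measurable cfK m0 e0 few_bad.
  by near: i; exact: (near_size_gt sigma_sofic).
rewrite lne_EFin ?ltr0n// -EFinM lee_fin ler_pdivlMr// mulrBl.
have : C <= r * (m i)%:R.
  rewrite -ler_pdivrMl// mulrC ltW//; near: i; exact: (near_size_gt sigma_sofic).
move: lo; rewrite /C /b; lra.
Unshelve. all: by end_near. Qed.

End LowerLimit.

(** * Equality of the two rates *)

Theorem theorem1p2 (R : realType) (G : groupType)
    (G_countable : countable [set: G]) (G_infinite : infinite_set [set: G])
    (G_amenable : amenable R G)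
    (d : measure_display) (X : measurableType d) (X_standard : standard_borel R X)
    (mu : probability X R) (T : G -> X -> X) (T_pmp : pmp_action mu T)
    (A : finType) (phi : X -> A)
    (phi_measurable : forall B : set A, measurable (phi @^-1` B))
    (m : nat -> nat) (sigma : forall i, G -> 'S_(m i))
    (sigma_sofic : sofic_approximation R sigma)
    (F : nat -> {fset G}) (F_folner : left_folner R F) :
  cvgn (fun n => entropy_per_site mu T phi (F n)) /\
  sofic_entropy_rate mu T phi sigma = (mean_entropy_rate mu T phi F)%:E.
Proof.
have F_cvg := cvg_entropy_per_site T_pmp phi_measurable F_folner.
split; first by apply/cvg_ex; exists (min_rate mu T phi).
rewrite /mean_entropy_rate (cvg_lim _ F_cvg)//; apply/eqP; rewrite eq_le.
by rewrite sofic_entropy_rate_le// (sofic_entropy_rate_ge _ _ _ F_folner).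
Qed.
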